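(* Let $m$ be a nonnegative integer and let $\alpha,a,b,b_1,\dots,b_m,c_1,\dots,c_m$ be complex numbers with $$\max\{|\alpha a|,|\alpha b|,|\alpha b_1|,|\alpha a c_1/q|,\dots,|\alpha b_m|,|\alpha a c_m/q|\}<1 .$$ Then $$\frac{(\alpha q,\alpha ab/q;q)_\infty}{(\alpha a,\alpha b;q)_\infty}\prod_{j=1}^m\frac{(\alpha a b_j/q,\alpha c_j;q)_\infty}{(\alpha a c_j/q,\alpha b_j;q)_\infty} =\sum_{n=0}^\infty\frac{(1-\alpha q^{2n})(\alpha,q/a;q)_n(a/q)^n}{(1-\alpha)(q,\alpha a;q)_n}\;{}_{m+2}\phi_{m+1}\left({q^{-n},\alpha q^n,\alpha c_1,\dots,\alpha c_m\atop \alpha b,\alpha b_1,\dots,\alpha b_m};q,q\right).$$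
   Context: Throughout $0<q<1$. Put $(x;q)_0=1$, $(x;q)_n=\prod_{k=0}^{n-1}(1-xq^k)$, $(x;q)_\infty=\prod_{k\ge0}(1-xq^k)$, and $(x_1,\dots,x_r;q)_n=(x_1;q)_n\cdots(x_r;q)_n$ for $n$ a nonnegative integer or $\infty$. The basic hypergeometric series is $${}_{r+1}\phi_r\left({a_1,\dots,a_{r+1}\atop b_1,\dots,b_r};q,z\right)=\sum_{k=0}^\infty\frac{(a_1,\dots,a_{r+1};q)_k}{(q,b_1,\dots,b_r;q)_k}z^k ;$$ when some $a_i=q^{-n}$ with $n\ge 0$ an integer, it is the finite sum over $0\le k\le n$. Removable singularities are read by continuity: $(q/a;q)_n(a/q)^n=q^{-n}\prod_{k=1}^n(a-q^k)$ also for $a=0$; and $(1-\alpha q^{2n})(\alpha;q)_n/(1-\alpha)$ means $1$ for $n=0$ and $(1-\alpha q^{2n})(\alpha q;q)_{n-1}$ for $n\ge1$, also for $\alpha=1$. *)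

(* Defs.v *)
From mathcomp Require Import all_boot all_order all_algebra complex.
From mathcomp Require Import all_classical all_reals all_analysis.

Set Implicit Arguments.
Unset Strict Implicit.
Unset Printing Implicit Defensive.

Import Order.TTheory GRing.Theory Num.Theory numFieldNormedType.Exports.
Local Open Scope classical_set_scope.
Local Open Scope ring_scope.

(* The complex numbers over R.  MathComp-Analysis attaches the norm topology to
   the sort of an abstract [numFieldType]; it is found for [Cplx R], but not for
   the bare type [R[i]]. *)
Definition Cplx (R : realType) : numClosedFieldType := R[i]%C.

Definition of_real (R : realType) (x : R) : Cplx R := (x%:C)%C.

Section QSeries.
Variable K : numFieldType.
Implicit Types (a q x z : K) (xs : seq K).

(* (x; q)_n *)
Definition qpoch q x (n : nat) : K := \prod_(k < n) (1 - x * q ^+ k).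

(* (x; q)_oo *)
Definition qpoch_inf q x : K := limn (qpoch q x).

(* (x_1, ..., x_r; q)_n and (x_1, ..., x_r; q)_oo *)
Definition qpochs q xs (n : nat) : K := \prod_(x <- xs) qpoch q x n.
Definition qpochs_inf q xs : K := \prod_(x <- xs) qpoch_inf q x.

(* The basic hypergeometric series.  If some upper parameter is q^-n, then all
   terms with k > n vanish (their numerator is 0, and 0 / 0 = 0), so the value is
   the finite sum over 0 <= k <= n. *)
Definition bhs_term (r : nat) (A : r.+1.-tuple K) (B : r.-tuple K) q z
    (k : nat) : K :=
  qpochs q A k / qpochs q (q :: B) k * z ^+ k.

Definition bhs (r : nat) (A : r.+1.-tuple K) (B : r.-tuple K) q z : K :=
  limn (series (bhs_term A B q z)).

(* (q/a; q)_n (a/q)^n, extended by continuity to a = 0; see [qpoch_shiftE]. *)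
Definition qpoch_shift q a (n : nat) : K :=
  q ^- n * \prod_(1 <= k < n.+1) (a - q ^+ k).

(* (1 - al q^(2n)) (al; q)_n / (1 - al), extended by continuity to al = 1;
   see [qpoch_vwpE]. *)
Definition qpoch_vwp q al (n : nat) : K :=
  if n is n'.+1 then (1 - al * q ^+ (2 * n)) * qpoch q (al * q) n' else 1.

Lemma qpoch_shiftE q a n : q != 0 -> a != 0 ->
  qpoch_shift q a n = qpoch q (q / a) n * (a / q) ^+ n.
Proof.
move=> q0 a0; rewrite /qpoch_shift /qpoch expr_div_n mulrA [RHS]mulrC.
congr (_ * _); rewrite big_add1 /= big_mkord -[X in _ * a ^+ X]card_ord.
rewrite -prodr_const -big_split /=; apply: eq_bigr => k _.
by rewrite mulrBl mul1r exprS mulrAC divfK.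
Qed.

Lemma qpoch_vwpE q al n : al != 1 ->
  qpoch_vwp q al n = (1 - al * q ^+ (2 * n)) * qpoch q al n / (1 - al).
Proof.
move=> al1; have al0 : 1 - al != 0 by rewrite subr_eq0 eq_sym.
case: n => [|n]; rewrite /qpoch_vwp /qpoch.
  by rewrite big_ord0 muln0 expr0 !mulr1 divff.
rewrite big_ord_recl expr0 mulr1 mulrCA [RHS]mulrC mulKf //.
by congr (_ * _); apply: eq_bigr => k _; rewrite exprS mulrA.
Qed.

Lemma bhs_terminates (r : nat) (A : r.+1.-tuple K) (B : r.-tuple K) q z n :
  q != 0 -> q ^- n \in (A : seq K) ->
  bhs A B q z = \sum_(k < n.+1) bhs_term A B q z k.
Proof.
move=> q0 qA; apply: lim_near_cst; first exact: norm_hausdorff.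
exists n.+1 => // N /= nN; rewrite /series /= (@big_cat_nat _ _ _ n.+1) //= big_mkord.
rewrite [X in _ + X]big_nat_cond [X in _ + X]big1 ?addr0 // => k /andP[/andP[nk _] _].
rewrite /bhs_term /qpochs (big_rem _ qA) /= {1}/qpoch (bigD1 (Ordinal nk)) //=.
by rewrite mulVf ?expf_neq0 // subrr !mul0r.
Qed.

End QSeries.

(* Main.v *)
Require Import Defs.
From mathcomp Require Import all_boot all_order all_algebra complex.
From mathcomp Require Import all_classical all_reals all_analysis.
From mathcomp Require Import ring.
Set Implicit Arguments.
Unset Strict Implicit.
Unset Printing Implicit Defensive.
Import Order.TTheory GRing.Theory Num.Theory numFieldNormedType.Exports.
Local Open Scope classical_set_scope.
Local Open Scope ring_scope.

(** Fix al, b, b_j, c_j and let a vary.  Put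
      G_k = (1 / (al b; q)_k) prod_j (al c_j; q)_k / (al b_j; q)_k,
    so that the inner series is phi_n = sum_k (q^-n, al q^n; q)_k / (q; q)_k q^k G_k.

    At a node a = q^(N+1) the factor (q/a; q)_n vanishes for n > N.  The outer
    sum is then finite and undoes the inner one, whatever the numbers G_k are:
    it equals (al q; q)_N G_N ([qbailey_inversion]).  This is the value of the
    infinite products there, so the theorem holds at the nodes in its domain.
    The inversion itself is a telescoping sum ([inversion_partial_sum]).

    The nodes tend to 0, so it remains to see that both sides are analytic in a.
    After multiplication by (al a; q)_oo and by the (al a c_j / q; q)_oo they
    are power series which converge absolutely for |a| <= rho, where rho is any
    radius with rho |al| < 1 and rho |al c_j| < q.  Such a series is handled
    through polynomials that form a Cauchy sequence for the majorant norm
    sum_i |p_i| rho^i; this norm is submultiplicative, hence products of such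
    sequences need no rearrangement of double series.  If a sequence of this
    kind tends to 0 at points that tend to 0, then each of its coefficients
    tends to 0, and so does the sequence at each point of the disc
    ([identity_principle]).

    The polynomial coming from the n-th term has majorant norm of order
    (rho / q)^n |phi_n|, so what is needed is phi_n = O(s^n) for some s with
    s rho < q.  The terms of phi_n are much larger than their sum, and a
    termwise bound fails.  But sum_k (q^-n; q)_k / (q; q)_k q^k u_k is the n-th
    q-difference of the sequence u at 0, that is, the value at 0 of the product
    of the operators 1 - q^-i E for i < n, where E is the shift ([qdiffE]).  The
    q-differences of (A; q)_k and of 1 / (B; q)_k have closed forms, and the
    q-Leibniz rule [qdiffM] combines them: G has n-th q-differences O(s^n) as
    soon as s exceeds each |al c_j| ([qsmooth_node_value]), and the factor
    (al q^n; q)_k, which changes with n, does no harm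
    ([qdiff_moving_bounded]). *)

(** * q-Pochhammer symbols *)

Section QPochhammer.
Variables (K : numFieldType) (q : K).

Lemma qpoch0 x : qpoch q x 0 = 1.
Proof. by rewrite /qpoch big_ord0. Qed.

Lemma qpochS x n : qpoch q x n.+1 = qpoch q x n * (1 - x * q ^+ n).
Proof. by rewrite /qpoch big_ord_recr. Qed.

Lemma qpochSl x n : qpoch q x n.+1 = (1 - x) * qpoch q (x * q) n.
Proof.
rewrite /qpoch big_ord_recl expr0 mulr1; congr (_ * _).
by apply: eq_bigr => k _; rewrite exprS mulrA.
Qed.

Lemma qpochD x m n : qpoch q x (m + n) = qpoch q x m * qpoch q (x * q ^+ m) n.
Proof.
elim: n => [|n IH]; first by rewrite addn0 qpoch0 mulr1.
by rewrite addnS !qpochS IH exprD !mulrA.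
Qed.

Lemma qpoch_neq0 x n : (forall k, 1 - x * q ^+ k != 0) -> qpoch q x n != 0.
Proof. by move=> x0; apply/prodf_neq0 => k _. Qed.

Hypothesis q01 : 0 < q < 1.

Lemma q_gt0 : 0 < q. Proof. by case/andP: q01. Qed.

Lemma q_ge0 : 0 <= q. Proof. exact: ltW q_gt0. Qed.

Lemma q_neq0 : q != 0. Proof. exact: lt0r_neq0 q_gt0. Qed.

Lemma qX_neq0 n : q ^+ n != 0. Proof. by rewrite expf_neq0 ?q_neq0. Qed.

Lemma subr1qX_neq0 n : 1 - q * q ^+ n != 0.
Proof.
by rewrite -exprS subr_eq0 eq_sym lt_eqF // exprn_ilt1 ?q_ge0 //; case/andP: q01.
Qed.

Lemma qpochq_neq0 n : qpoch q q n != 0.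
Proof. by apply: qpoch_neq0 => k; exact: subr1qX_neq0. Qed.

(** * The q-difference operators *)

Fixpoint qdiff n (u : nat -> K) i : K :=
  if n is n'.+1 then qdiff n' u i - q ^- n' * qdiff n' u i.+1 else u i.

Lemma eq_qdiff n u v i : u =1 v -> qdiff n u i = qdiff n v i.
Proof. by move=> uv; elim: n i => [|n IH] i /=; rewrite ?uv // !IH. Qed.

Definition qdiff_coef n k := qpoch q (q ^- n) k / qpoch q q k * q ^+ k.

Lemma qdiff_coef0 n : qdiff_coef n 0 = 1.
Proof. by rewrite /qdiff_coef !qpoch0 divr1 mulr1. Qed.

Lemma qdiff_coefSn n : qdiff_coef n n.+1 = 0.
Proof. by rewrite /qdiff_coef qpochS mulVf ?qX_neq0 // subrr mulr0 !mul0r. Qed.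

(** Expanding the product of the operators 1 - q^-i E one factor at a time gives
    this Pascal rule for the coefficient of E^k. *)
Lemma qdiff_coefS n k :
  qdiff_coef n.+1 k.+1 = qdiff_coef n k.+1 - q ^- n * qdiff_coef n k.
Proof.
rewrite /qdiff_coef qpochSl !(qpochS _ k) !exprS.
have -> : (q * q ^+ n)^-1 * q = q ^- n.
  by rewrite invfM mulrAC mulVf ?q_neq0 ?mul1r.
have := q_neq0; have := qX_neq0 n; have := qX_neq0 k; have := subr1qX_neq0 k.
have := qpochq_neq0 k.
move: (qpoch q (q ^- n) k) (qpoch q q k) (q ^+ n) (q ^+ k) => x y z w y0 d0 w0 z0 h.
by field; rewrite ?y0 ?d0 ?w0 ?z0 ?h.
Qed.

Lemma qdiffE n u i : qdiff n u i = \sum_(k < n.+1) qdiff_coef n k * u (i + k)%N.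
Proof.
elim: n i => [|n IH] i /=.
  by rewrite big_ord_recl big_ord0 qdiff_coef0 mul1r addr0 addn0.
rewrite 2!IH [RHS]big_ord_recl qdiff_coef0.
under [in RHS]eq_bigr => k _ do rewrite qdiff_coefS mulrBl.
rewrite sumrB addrA; congr (_ - _).
  rewrite -[X in X * _](qdiff_coef0 n).
  rewrite -(big_ord_recl n.+1 (fun k => qdiff_coef n k * u (i + k)%N)).
  by rewrite [RHS]big_ord_recr /= qdiff_coefSn mul0r addr0.
rewrite mulr_sumr; apply: eq_bigr => k _.
by rewrite /= /bump /= add1n addnS mulrA.
Qed.

(** The case i = 0 is the q-Chu-Vandermonde sum with lower parameter 0. *)
Lemma qdiff_qpoch A n i : qdiff n (qpoch q A) i = qpoch q A i * (A * q ^+ i) ^+ n.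
Proof.
elim: n i => [|n IH] i /=; first by rewrite mulr1.
rewrite !IH qpochS [in RHS]exprS (exprS q i) [A * (q * _)]mulrCA (exprMn _ q).
by have := qX_neq0 n; move: (q ^+ n) (_ ^+ n) => x y x0; field.
Qed.

Lemma qdiff_inv_qpoch B n i : (forall k, 1 - B * q ^+ k != 0) ->
  qdiff n (fun k => (qpoch q B k)^-1) i =
  \prod_(j < n) (- (B * q ^+ j)) * q ^+ (i * n) / qpoch q B (i + n).
Proof.
move=> B0; elim: n i => [|n IH] i /=.
  by rewrite big_ord0 muln0 addn0 !mul1r.
rewrite !IH big_ord_recr /= addSn addnS qpochS mulnS mulSn !exprD.
have := qX_neq0 n; have := B0 (i + n)%N; have := qpoch_neq0 (i + n) B0.
rewrite exprD; move: (qpoch _ _ _) (\prod_(j < n) _) (q ^+ i) (q ^+ n) (q ^+ (i * n)).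
move=> x y z w t x0 h w0; field; by rewrite ?x0 ?h ?w0.
Qed.

(** The Gaussian binomial coefficient in base 1/q, see [leibniz_coefE]. *)
Fixpoint leibniz_coef n k : K :=
  match n, k with
  | 0, 0 => 1
  | 0, _.+1 => 0
  | n'.+1, 0 => leibniz_coef n' 0
  | n'.+1, k'.+1 => leibniz_coef n' k' + q ^- k * leibniz_coef n' k
  end.

Lemma leibniz_coef_gt n k : (n < k)%N -> leibniz_coef n k = 0.
Proof.
elim: n k => [|n IH] [|k] //= nk.
by rewrite !IH ?mulr0 ?addr0 // ltnW.
Qed.

(** The q-Leibniz rule.  The induction step rests on
    1 - q^-n E E' = (1 - q^-k E) + q^-k E (1 - q^-(n-k) E'), where E and E' are
    the shifts of the two factors; this is why the first factor is read
    n - k places further on. *)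
Lemma qdiffM u v n i : qdiff n (fun k => u k * v k) i =
  \sum_(k < n.+1) leibniz_coef n k *
    (qdiff k u (i + (n - k)) * qdiff (n - k) v i).
Proof.
elim: n i => [|n IH] i /=; first by rewrite big_ord_recl big_ord0 /= mul1r addr0 addn0.
rewrite !IH.
pose F k := qdiff k u (i + (n.+1 - k)) * qdiff (n.+1 - k) v i.
pose c := leibniz_coef n.
have E (k : 'I_n.+1) : c k * (qdiff k u (i + (n - k)) * qdiff (n - k) v i) -
   q ^- n * (c k * (qdiff k u (i.+1 + (n - k)) * qdiff (n - k) v i.+1)) =
   c k * F k.+1 + q ^- k * c k * F k.
  rewrite /F subSS (subSn (ltn_ord k : k <= n)%N) /= addSn addnS.
  have -> : q ^- n = q ^- k * q ^- (n - k).
    by rewrite -invfM -exprD subnKC // -ltnS.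
  ring.
rewrite mulr_sumr -sumrB (eq_bigr _ (fun k _ => E k)).
rewrite [RHS]big_ord_recl /= -/(F 0%N) big_split /= addrC.
have -> : \sum_(k < n.+1) q ^- k * c k * F k =
    c 0%N * F 0%N + \sum_(k < n.+1) q ^- k.+1 * c k.+1 * F k.+1.
  transitivity (\sum_(k < n.+2) q ^- k * c k * F k).
    by rewrite [RHS]big_ord_recr /= (_ : c n.+1 = 0) ?mulr0 ?mul0r ?addr0 //;
       exact: leibniz_coef_gt.
  by rewrite big_ord_recl /= expr0 invr1 mul1r.
rewrite -addrA -big_split; congr (_ + _); apply: eq_bigr => k _ /=.
by rewrite /bump /= add1n -/(F k.+1) mulrDl addrC.
Qed.

Lemma leibniz_coefE k l : leibniz_coef (k + l) k =
  q ^- (k * l) * qpoch q q (k + l) / (qpoch q q k * qpoch q q l).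
Proof.
suff H n : forall k l, (k + l)%N = n -> leibniz_coef (k + l) k =
  q ^- (k * l) * qpoch q q (k + l) / (qpoch q q k * qpoch q q l) by exact: (H _ _ _ erefl).
elim: n => [|n IH] {k l} [|k] l //.
- by rewrite add0n => ->; rewrite !qpoch0 expr0 invr1 !mul1r invr1.
- rewrite add0n => El; rewrite El /= -{1}[n]add0n IH ?add0n // qpoch0 !mul0n expr0.
  by rewrite invr1 !mul1r !divff ?qpochq_neq0.
case: l => [|l].
  rewrite addn0 => -[E] /=; rewrite (leibniz_coef_gt (ltnSn k)) mulr0 addr0.
  have := IH k 0%N; rewrite addn0 => -> //.
  by rewrite !muln0 qpoch0 !mulr1 expr0 invr1 !mul1r !divff ?qpochq_neq0.
rewrite addSn => -[E] /=; have E2 : (k.+1 + l)%N = n by rewrite addSn -addnS.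
have := IH _ _ E; have := IH _ _ E2; rewrite E E2 => -> ->.
rewrite !mulSn mulnS (qpochS _ n) (qpochS _ k) (qpochS _ l).
have En : q ^+ n = q ^+ (k + l.+1) by rewrite E.
rewrite En !exprD !exprS.
have := subr1qX_neq0 k; have := subr1qX_neq0 l.
have := qX_neq0 (k * l); have := qX_neq0 k; have := qX_neq0 l; have := q_neq0.
have := qpochq_neq0 k; have := qpochq_neq0 l.
move: (qpoch _ _ k) (qpoch _ _ l) (qpoch _ _ n) (q ^+ k) (q ^+ l) (q ^+ (k * l)).
move=> a b c x y z *; field; by do ! (apply/andP; split).
Qed.

End QPochhammer.

(** * Inversion *)

Section Inversion.
Variables (K : numFieldType) (q : K).
Hypothesis q01 : 0 < q < 1.
Let q0 := q_neq0 q01.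
Let qX0 := qX_neq0 q01.
Implicit Types (al z : K) (G : nat -> K).

Lemma qpoch_shift0 z : qpoch_shift q z 0 = 1.
Proof. by rewrite /qpoch_shift big_geq // expr0 invr1 mulr1. Qed.

Lemma qpoch_shiftS z n :
  qpoch_shift q z n.+1 = qpoch_shift q z n * (q^-1 * (z - q ^+ n.+1)).
Proof.
rewrite /qpoch_shift big_nat_recr //=.
by rewrite (_ : q ^- n.+1 = q^-1 * q ^- n) ?exprS ?invfM //; ring.
Qed.

Lemma qpoch_vwp_diag al k :
  qpoch_vwp q al k * qpoch q (al * q ^+ k) k = qpoch q (al * q) (k + k).
Proof.
case: k => [|k]; first by rewrite addn0 !qpoch0 mul1r.
rewrite /qpoch_vwp -mulrA [in RHS]addSn [in RHS]qpochS [in RHS]qpochD mulrC.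
have E m : al * q * q ^+ m = al * q ^+ m.+1 by rewrite -mulrA -exprS.
by rewrite !E -addSn addnn -mul2n.
Qed.

Lemma qpoch_vwpS al k i :
  qpoch_vwp q al (k + i).+1 * qpoch q (al * q ^+ (k + i).+1) k =
  (1 - al * q ^+ (2 * (k + i).+1)) * qpoch q (al * q) (k + k + i).
Proof.
rewrite /qpoch_vwp -mulrA; congr (_ * _).
by rewrite (addnAC k k i) [in RHS]qpochD -[al * q * _]mulrA -exprS.
Qed.

Lemma qdiff_coef_gt n k : (n < k)%N -> qdiff_coef q n k = 0.
Proof.
move=> nk; rewrite /qdiff_coef /qpoch (bigD1 (Ordinal nk)) //=.
by rewrite mulVf // subrr !mul0r.
Qed.

(** With k fixed, the dependence of the coefficient on n = k + i is reduced to
    a geometric factor over (q; q)_i: this is what makes the sum over n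
    telescope. *)
Lemma qdiff_coef_shift k i :
  qdiff_coef q (k + i).+1 k / qpoch q q (k + i).+1 =
  qdiff_coef q (k + i) k / qpoch q q (k + i) * (q ^- k / (1 - q * q ^+ i)).
Proof.
rewrite /qdiff_coef qpochS.
have E : qpoch q (q ^- (k + i).+1) k * (1 - q ^- i.+1) =
         (1 - q ^- (k + i).+1) * qpoch q (q ^- (k + i)) k.
  have -> : q ^- i.+1 = q ^- (k + i).+1 * q ^+ k.
    by rewrite -addnS exprD invfM mulrAC mulVf // mul1r.
  rewrite -qpochS qpochSl; congr (_ * qpoch _ _ _).
  by rewrite exprS invfM mulrAC mulVf // mul1r.
have i1 : 1 - q ^- i.+1 != 0.
  by rewrite subr_eq0 eq_sym invr_eq1 -subr_eq0 -oppr_eq0 opprB exprS subr1qX_neq0.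
rewrite -[qpoch q (q ^- (k + i).+1) k](mulfK i1) E !exprS exprD.
have := subr1qX_neq0 q01 (k + i); have := subr1qX_neq0 q01 i; rewrite exprD.
move: i1; rewrite exprS.
have := qpochq_neq0 q01 k; have := qpochq_neq0 q01 (k + i).
have := qX0 k; have := qX0 i; have := q0.
move: (qpoch q _ k) (qpoch q q k) (qpoch q q (k + i)) => a b c.
move: (q ^+ k) (q ^+ i) => x y Q0 y0 x0 c0 b0 h1 h2 h3.
field; do ! (apply/andP; split) => //.
by rewrite -oppr_eq0 opprB.
Qed.

(** The indefinite sum of a very-well-poised series, shifted by k.  Up to common
    factors, the step from I - 1 to I is the identity
    (1 - al q^(2k+I)) (z - q^(k+1+I)) - q^(k+1) (1 - q^I) (1 - al z q^(k+I-1))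
      = (z - q^(k+1)) (1 - al q^(2k+2I)). *)
Lemma inversion_partial_sum al z k I : (forall n, 1 - al * z * q ^+ n != 0) ->
  \sum_(i < I.+1) qpoch_vwp q al (k + i) * qpoch q (al * q ^+ (k + i)) k *
     qpoch_shift q z (k + i) / qpoch q (al * z) (k + i) *
     (qdiff_coef q (k + i) k / qpoch q q (k + i)) =
  qpoch q (al * q) (k + k + I) *
    (qpoch_shift q z k * q ^- I * \prod_(j < I) (z - q ^+ (k + j).+2)) /
    qpoch q (al * z) (k + I) * (qdiff_coef q (k + I) k / qpoch q q (k + I)).
Proof.
move=> alz0; elim: I => [|I IH].
  by rewrite big_ord_recl !big_ord0 !addn0 addr0 qpoch_vwp_diag expr0 invr1 !mulr1.
rewrite big_ord_recr IH /= !addnS qpoch_vwpS qdiff_coef_shift.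
have {IH} S j : qpoch_shift q z (k + j).+1 =
    qpoch_shift q z k * q ^- j.+1 *
      ((z - q ^+ k.+1) * \prod_(l < j) (z - q ^+ (k + l).+2)).
  elim: j => [|j IHj]; first by rewrite addn0 qpoch_shiftS big_ord0 expr1 mulr1 mulrA.
  rewrite addnS qpoch_shiftS IHj big_ord_recr /=.
  by rewrite (_ : q ^- j.+2 = q^-1 * q ^- j.+1) ?(exprS q j.+1) ?invfM //; ring.
rewrite S (big_ord_recr I) /= (qpochS _ (al * q)) (qpochS _ (al * z)).
rewrite mul2n -addnn !exprS !exprD !exprS !exprD.
have := subr1qX_neq0 q01 I; have := alz0 (k + I)%N; have := qpoch_neq0 (k + I) alz0.
have := qX0 k; have := qX0 I; have := q0; rewrite !exprD.
move: (qpoch q (al * z) _) (qpoch q (al * q) _) (_ / qpoch q q _) (\prod_(j < I) _).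
move: (qpoch_shift q z k) (q ^+ k) (q ^+ I) => a x y b c d e Q0 y0 x0 b0 h1 h2.
field; do ! (apply/andP; split) => //.
Qed.

(** Both factors are products of differences of powers of q; reversing the order
    in one of them pairs the differences up, and the remaining powers of q
    cancel. *)
Lemma inversion_corner N :
  qpoch_shift q (q ^+ N.+1) N * (qdiff_coef q N N / qpoch q q N) = 1.
Proof.
have E : \prod_(1 <= k < N.+1) (q ^+ N.+1 - q ^+ k) * qpoch q (q ^- N) N =
         qpoch q q N * qpoch q q N.
  rewrite big_add1 big_mkord /= /qpoch -big_split -big_split /=.
  rewrite (reindex_inj rev_ord_inj) /=.
  transitivity (\prod_(k < N) ((1 - q * q ^+ k) * (1 - q * q ^+ k)) *
     (\prod_(k < N) q ^+ (N - k)) * \prod_(k < N) q ^- (k.+1)).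
    rewrite -!big_split; apply: eq_bigr => -[k kN] _ /=.
    have -> : q ^+ N.+1 = q ^+ (N - k) * (q * q ^+ k).
      by rewrite -exprS -exprD addnS subnK // ltnW.
    rewrite subnSK //.
    have -> : q ^- N * q ^+ (N - k.+1) = q ^- k.+1.
      by rewrite -[X in q ^- X](subnKC kN) exprD invfM -mulrA mulVf ?mulr1.
    rewrite exprS; have := qX0 k; have := q0; move: (q ^+ k) (q ^+ (N - k)) => x y Q0 x0.
    by field; rewrite ?Q0 ?x0.
  rewrite -mulrA [X in _ * (X * _)](reindex_inj rev_ord_inj) /=.
  rewrite -[X in _ * X]big_split /= [X in _ * X]big1 ?mulr1 // => k _.
  by rewrite subKn ?divff // ltn_ord.
have c0 := qpochq_neq0 q01 N.
rewrite -[RHS](divff (mulf_neq0 c0 c0)) -[X in _ = X / _]E /qpoch_shift /qdiff_coef.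
move: (\prod_(1 <= k < _) _) (qpoch q (q ^- N) N) (qpoch q q N) c0 => a b c c0.
by have := qX0 N; move: (q ^+ N) => d d0; field; rewrite c0.
Qed.

(** After the two sums are exchanged, the coefficient of G_k is the partial sum
    above taken up to n = N.  For k < N it contains the factor z - q^(N+1),
    which is 0; for k = N only one term is left. *)
Lemma qbailey_inversion al G N : (forall n, 1 - al * q ^+ N.+1 * q ^+ n != 0) ->
  \sum_(n < N.+1) qpoch_vwp q al n * qpoch_shift q (q ^+ N.+1) n /
     (qpoch q q n * qpoch q (al * q ^+ N.+1) n) *
     qdiff q n (fun k => qpoch q (al * q ^+ n) k * G k) 0 =
  qpoch q (al * q) N * G N.
Proof.
move=> alz0; set z := q ^+ N.+1.
pose t n k := qpoch_vwp q al n * qpoch q (al * q ^+ n) k *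
     qpoch_shift q z n / qpoch q (al * z) n * (qdiff_coef q n k / qpoch q q n).
transitivity (\sum_(k < N.+1) G k * \sum_(n < N.+1) t n k).
  under [RHS]eq_bigr => k _ do rewrite mulr_sumr.
  rewrite exchange_big; apply: eq_bigr => n _ /=.
  rewrite (qdiffE q01) mulr_sumr.
  pose F k := qpoch_vwp q al n * qpoch_shift q z n /
    (qpoch q q n * qpoch q (al * z) n) *
    (qdiff_coef q n k * (qpoch q (al * q ^+ n) k * G k)).
  transitivity (\sum_(k < N.+1) F k); last first.
    by apply: eq_bigr => k _; rewrite /F /t invfM; ring.
  rewrite -!(big_mkord xpredT F) (@big_cat_nat _ _ _ n.+1 0 N.+1) //=.
  rewrite [X in _ = _ + X]big_nat [X in _ = _ + X]big1 ?addr0 //.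
  by move=> k /andP[nk _]; rewrite /F qdiff_coef_gt // !(mul0r, mulr0).
have tE (k : 'I_N.+1) : \sum_(n < N.+1) t n k = \sum_(i < (N - k).+1) t (k + i)%N k.
  rewrite -(big_mkord xpredT (fun n => t n k)).
  rewrite (@big_cat_nat _ _ _ k 0 N.+1) //=; last exact: ltnW.
  rewrite big_nat big1 ?add0r; last first.
    by move=> n /= nk; rewrite /t qdiff_coef_gt // !(mul0r, mulr0).
  rewrite -{1}[X in index_iota X](add0n (k : nat)) big_addn subSn ?big_mkord -1?ltnS //.
  by apply: eq_bigr => i _; rewrite addnC.
under eq_bigr => k _ do rewrite tE (inversion_partial_sum _ _ alz0).
rewrite big_ord_recr /= big1 ?add0r.
  rewrite subnn big_ord0 !addn0 expr0 invr1 !mulr1 mulrC.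
  rewrite qpochD -[al * q * _]mulrA -exprS.
  rewrite -/z -[RHS]mulr1 -(inversion_corner N) -/z.
  have := qpoch_neq0 N alz0; rewrite -/z.
  move: (_ / qpoch q q N) (qpoch_shift q z N) (qpoch q (al * z) N) => b a c c0.
  by field.
move=> k _; rewrite (_ : \prod_(j < N - k) _ = 0) ?(mulr0, mul0r) //.
have kN : (0 < N - k)%N by rewrite subn_gt0.
have h : ((N - k).-1 < N - k)%N by rewrite prednK.
rewrite (bigD1 (Ordinal h)) //= (_ : (k + (N - k).-1).+2 = N.+1) ?subrr ?mul0r //.
by rewrite -addnS prednK // subnKC // ltnW.
Qed.

End Inversion.

(** * Convergence of complex sequences *)

Section ComplexSequences.
Variable R : realType.
Local Notation C := (Cplx R).
Local Notation re := (@complex.Re R).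
Local Notation im := (@complex.Im R).

Lemma of_realB (x y : R) : of_real (x - y) = of_real x - of_real y.
Proof. exact: (rmorphB (real_complex R)). Qed.

Lemma of_realX (x : R) n : of_real (x ^+ n) = of_real x ^+ n.
Proof. exact: (rmorphXn (real_complex R)). Qed.

Lemma normr_of_real (x : R) : `|of_real x| = of_real `|x|.
Proof. by rewrite /of_real (normc_def x%:C%C) /= expr0n addr0 sqrtr_sqr. Qed.

Lemma ltr_of_real (x y : R) : (of_real x < of_real y) = (x < y).
Proof. exact: ltcR. Qed.

Lemma ler_of_real (x y : R) : (of_real x <= of_real y) = (x <= y).
Proof. exact: lecR. Qed.

Lemma ge0_of_real (x : C) : 0 <= x -> x = of_real (re x).
Proof. by move=> /ger0_real /(@RRe_real R). Qed.

Lemma cvg_of_real (u : R^nat) (l : R) :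
  u @ \oo --> l -> (fun n => of_real (u n)) @ \oo --> of_real l.
Proof.
move=> /cvgrPdist_lt ul; apply/cvgrPdist_lt => e e0.
have Ee := ge0_of_real (ltW e0); move: e0; rewrite Ee ltr_of_real => e0.
near=> n; rewrite -of_realB normr_of_real ltr_of_real.
by near: n; exact: ul.
Unshelve. all: by end_near. Qed.

Lemma of_real_ge0 (x : R) : (0 <= of_real x) = (0 <= x).
Proof. exact: ler0c. Qed.

Lemma cvg_exprn0 (x : C) : `|x| < 1 -> (fun n => x ^+ n) @ \oo --> (0 : C).
Proof.
move=> x1; apply: norm_cvg0.
have -> : (fun n => `|x ^+ n|) = (fun n => `|x| ^+ n).
  by apply/funext => n; exact: normrX.
move: x1 (normr_ge0 x); rewrite (ge0_of_real (normr_ge0 x)) ltr_of_real of_real_ge0.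
move: (re _) => r r1 r0.
have -> : (fun n => of_real r ^+ n) = (fun n => of_real (r ^+ n)).
  by apply/funext => n; rewrite of_realX.
by apply: (@cvg_of_real (fun n => r ^+ n) 0); apply: cvg_expr; rewrite ger0_norm.
Qed.

Lemma real_cvgn_geometric (u : R^nat) D t : 0 <= t -> t < 1 ->
  (forall n, `|u n.+1 - u n| <= D * t ^+ n) -> cvgn u.
Proof.
move=> t0 t1 ut.
have D0 : 0 <= D by have := le_trans (normr_ge0 _) (ut 0%N); rewrite mulr1.
have -> : u = (fun n => u 0%N + series (telescope u) n).
  by apply/funext => n; exact: eq_sum_telescope.
apply: is_cvgD; first exact: is_cvg_cst.
apply: normed_cvg; apply: (@series_le_cvg _ _ (geometric D t)).
- by move=> n; exact: normr_ge0.
- by move=> n; exact: geometric_ge0.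
- exact: ut.
- by apply: is_cvg_geometric_series; rewrite ger0_norm.
Qed.

Lemma ler_norm_re (z : C) : of_real `|re z| <= `|z|.
Proof. exact: normc_ge_Re. Qed.

Lemma norm_i : `|('i%C : C)| = 1.
Proof.
by rewrite [LHS](@normc_def R) /= expr0n expr1n add0r sqrtr1.
Qed.

Lemma ler_norm_im (z : C) : of_real `|im z| <= `|z|.
Proof.
have := ler_norm_re (z * ('i%C : C)).
by rewrite normrM norm_i mulr1 [re _](@ReiNIm R) normrN.
Qed.

Lemma ler_norm_reim (z : C) : `|z| <= of_real `|re z| + of_real `|im z|.
Proof.
have {1}-> : z = of_real (re z) + ('i%C : C) * of_real (im z) by exact: complexE.
by rewrite (le_trans (ler_normD _ _)) // normrM norm_i mul1r !normr_of_real.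
Qed.

(** Completeness of the complex numbers, in the only form used below. *)
Lemma cvgn_geometric (u : C^nat) (D t : C) : 0 <= t -> t < 1 ->
  (forall n, `|u n.+1 - u n| <= D * t ^+ n) -> cvgn u.
Proof.
move=> t0 t1 ut.
have D0 : 0 <= D by have := le_trans (normr_ge0 _) (ut 0%N); rewrite mulr1.
move: D0 t0 t1 ut => /[dup] /ge0_of_real -> _ /[dup] /ge0_of_real ->.
move: (re D) (re t) => d s; rewrite of_real_ge0 => s0 s1 ut.
have {}ut n : `|u n.+1 - u n| <= of_real (d * s ^+ n).
  by apply: le_trans (ut n) _; rewrite /of_real rmorphM rmorphXn.
have {}s1 : s < 1 by rewrite -ltr_of_real.
have /cvg_ex[/= a ua] : cvgn (fun n => re (u n)).
  apply: (@real_cvgn_geometric _ d s) => // n; rewrite -ler_of_real.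
  by rewrite -raddfB; apply: le_trans (ut n); exact: ler_norm_re.
have /cvg_ex[/= b ub] : cvgn (fun n => im (u n)).
  apply: (@real_cvgn_geometric _ d s) => // n; rewrite -ler_of_real.
  by rewrite -raddfB; apply: le_trans (ut n); exact: ler_norm_im.
apply: (@cvgP C _ (Complex a b)); apply/cvgrPdist_lt => e e0.
move: (e0); rewrite (ge0_of_real (ltW e0)) ltr_of_real; move: (re e) => {e0} {}e e0.
have e20 : 0 < e / 2 by rewrite divr_gt0.
move/cvgrPdist_lt/(_ _ e20): ua => ua; move/cvgrPdist_lt/(_ _ e20): ub => ub.
near=> n; apply: le_lt_trans (ler_norm_reim _) _.
rewrite !raddfB /= (splitr e) [of_real (_ + _)](rmorphD (real_complex R)).
apply: ltrD; rewrite ltr_of_real.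
  by near: n.
by near: n.
Unshelve. all: by end_near. Qed.

End ComplexSequences.

Section Bounds.
Variable R : realType.
Local Notation C := (Cplx R).
Variable q : C.
Hypothesis q01 : 0 < q < 1.
Let q0 := q_neq0 q01.
Let qX0 := qX_neq0 q01.
Let qge0 := q_ge0 q01.
Let qXge0 n : 0 <= q ^+ n. Proof. exact: exprn_ge0. Qed.
Let qXgt0 n : 0 < q ^+ n. Proof. by rewrite exprn_gt0 // q_gt0. Qed.
Let qlt1 : q < 1. Proof. by case/andP: q01. Qed.
Let qXle1 n : q ^+ n <= 1. Proof. by rewrite exprn_ile1 // ltW. Qed.

(** * Bounds on q-Pochhammer symbols *)

Lemma cvg_qX : (fun n => q ^+ n) @ \oo --> (0 : C).
Proof. by apply: cvg_exprn0; rewrite ger0_norm. Qed.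

Lemma exists_qX_lt (e : C) : 0 < e -> exists n, q ^+ n < e.
Proof.
move=> e0; have /cvgrPdist_lt/(_ e e0)[N _ /(_ N)] := cvg_qX.
by move=> /(_ (leqnn N)) /=; rewrite sub0r normrN ger0_norm // => h; exists N.
Qed.

Lemma qpochN_ge1 (y : C) n : 0 <= y -> 1 <= qpoch q (- y) n.
Proof.
move=> y0; elim: n => [|n IH]; first by rewrite qpoch0.
by rewrite qpochS mulr_ege1 // mulNr opprK lerDl mulr_ge0.
Qed.

Lemma qpochN_homo (y : C) m n : 0 <= y -> (m <= n)%N ->
  qpoch q (- y) m <= qpoch q (- y) n.
Proof.
move=> y0 /subnKC <-; rewrite qpochD ler_peMr //.
  exact: le_trans (qpochN_ge1 m y0).
by rewrite mulNr qpochN_ge1 // mulr_ge0.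
Qed.

(** The bound 2 - q^n, rather than just 2, is what the induction carries. *)
Lemma qpochN_small (w : C) n : 0 <= w -> w *+ 2 <= 1 - q ->
  qpoch q (- w) n <= 2 - q ^+ n.
Proof.
move=> w0 wq; elim: n => [|n IH].
  by rewrite qpoch0 expr0 [2]mulr2n addrK.
rewrite qpochS mulNr opprK; have h : 0 <= 1 + w * q ^+ n.
  by rewrite addr_ge0 ?mulr_ge0.
apply: le_trans (ler_wpM2r h IH) _.
rewrite -subr_ge0; set X := (X in 0 <= X).
have -> : X = q ^+ n * ((1 - q) - w *+ 2 + w * q ^+ n).
  by rewrite /X exprS; ring.
by rewrite mulr_ge0 // addr_ge0 ?mulr_ge0 // subr_ge0.
Qed.

(** The product (- y; q)_n of the 1 + y q^k is the majorant behind every bound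
    that follows.  Shifting y by a power of q makes [qpochN_small] apply. *)
Lemma qpochN_bounded (y : C) : 0 <= y ->
  exists2 E : C, 0 <= E & forall n, qpoch q (- y) n <= E.
Proof.
move=> y0; have [N hN] : exists N, q ^+ N < (1 - q) / (y *+ 2 + 1).
  by apply: exists_qX_lt; rewrite divr_gt0 ?subr_gt0 // ltr_wpDl // mulrn_wge0.
have E1 := qpochN_ge1 N y0.
have Ege0 : 0 <= qpoch q (- y) N := le_trans ler01 E1.
exists (qpoch q (- y) N * 2); first by rewrite mulr_ge0.
move=> n; apply: le_trans (qpochN_homo y0 (leq_addl N n)) _.
rewrite qpochD ler_wpM2l // mulNr.
apply: (@le_trans _ _ (2 - q ^+ n)); last by rewrite gerBl.
apply: qpochN_small; first by rewrite mulr_ge0.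
have d0 : 0 < y *+ 2 + 1 by rewrite ltr_wpDl // mulrn_wge0.
rewrite -mulrnAl; move: hN; rewrite ltr_pdivlMr // mulrC => /ltW; apply: le_trans.
by rewrite ler_wpM2r // lerDl.
Qed.

Lemma ler_norm_qpoch (x : C) n : `|qpoch q x n| <= qpoch q (- `|x|) n.
Proof.
rewrite /qpoch normr_prod; apply: ler_prod => k _; rewrite normr_ge0 /=.
by rewrite (le_trans (ler_normB _ _)) // normr1 normrM mulNr opprK (ger0_norm (qXge0 k)).
Qed.

(** For 0 <= x < 1 one has 1 / (1 - x q^k) <= 1 + x / (1 - x) q^k, so inverses
    are bounded by a product of the same shape. *)
Lemma ler_norm_qpochV (x : C) n : `|x| < 1 ->
  `|(qpoch q x n)^-1| <= qpoch q (- (`|x| / (1 - `|x|))) n.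
Proof.
move=> x1; rewrite normfV /qpoch normr_prod -prodfV; apply: ler_prod => k _.
have x10 : 0 < 1 - `|x| by rewrite subr_gt0.
have h : 1 - `|x| * q ^+ k <= `|1 - x * q ^+ k|.
  apply: le_trans (lerB_dist _ _); rewrite normr1 normrM.
  by rewrite (ger0_norm (qXge0 k)).
have xq : `|x| * q ^+ k <= `|x| by rewrite ler_piMr.
have h0 : 0 < 1 - `|x| * q ^+ k.
  by apply: lt_le_trans x10 _; rewrite lerD2l lerN2.
rewrite invr_ge0 normr_ge0 /=.
apply: le_trans (_ : (1 - `|x| * q ^+ k)^-1 <= _).
  by rewrite lef_pV2 ?posrE //; exact: lt_le_trans h.
rewrite mulNr opprK -[X in X <= _]mul1r ler_pdivrMr //.
rewrite -subr_ge0; set X := (X in 0 <= X).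
have -> : X = `|x| * q ^+ k * (`|x| - `|x| * q ^+ k) / (1 - `|x|).
  by rewrite /X; field; rewrite lt0r_neq0.
by rewrite divr_ge0 ?(ltW x10) // !mulr_ge0 // subr_ge0.
Qed.

Lemma qpoch_bounded (x : C) :
  exists2 E : C, 0 <= E & forall n, `|qpoch q x n| <= E.
Proof.
have [E E0 EP] := qpochN_bounded (normr_ge0 x); exists E => // n.
exact: le_trans (ler_norm_qpoch x n) (EP n).
Qed.

Lemma qpochV_bounded (x : C) : `|x| < 1 ->
  exists2 E : C, 0 < E & forall n, `|(qpoch q x n)^-1| <= E.
Proof.
move=> x1; have [|E E0 EP] := @qpochN_bounded (`|x| / (1 - `|x|)).
  by rewrite divr_ge0 // ltW // subr_gt0.
exists (E + 1) => [|n]; first by rewrite ltr_wpDl.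
by apply: le_trans (ler_norm_qpochV n x1) _; rewrite (le_trans (EP n)) // lerDl.
Qed.

Lemma subr1_qX_neq0 (x : C) k : `|x| < 1 -> 1 - x * q ^+ k != 0.
Proof.
move=> x1; rewrite subr_eq0; apply: contraTneq x1 => /(congr1 (fun y => `|y|)).
rewrite normr1 normrM (ger0_norm (qXge0 k)) => E; apply/negP => x1.
suff: 1 < 1 :> C by rewrite ltxx.
by rewrite {1}E (le_lt_trans _ x1) // ler_piMr.
Qed.

(** * Infinite products *)

Lemma is_cvg_qpoch (x : C) : cvgn (qpoch q x).
Proof.
have [E E0 EP] := qpoch_bounded x.
apply: (@cvgn_geometric _ _ (E * `|x|) q) => // n.
rewrite qpochS mulrBr mulr1 addrC addKr normrN !normrM (ger0_norm (qXge0 n)).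
by rewrite mulrA ler_wpM2r // ler_wpM2r.
Qed.

Lemma cvg_qpoch (x : C) : qpoch q x @ \oo --> qpoch_inf q x.
Proof. exact: is_cvg_qpoch. Qed.

Lemma qpoch_inf_neq0 (x : C) : `|x| < 1 -> qpoch_inf q x != 0.
Proof.
move=> x1; have [E E0 EP] := qpochV_bounded x1.
apply/eqP => x0; have := @cvg_qpoch x; rewrite x0 => /cvgrPdist_lt.
have V0 : 0 < E^-1 by rewrite invr_gt0.
move=> /(_ _ V0)[N _ /(_ N (leqnn N))] /=; rewrite sub0r normrN.
have n0 : qpoch q x N != 0 by apply: qpoch_neq0 => k; exact: subr1_qX_neq0.
have := EP N; rewrite normfV -[X in _ <= X]invrK lef_pV2 ?posrE ?normr_gt0 //.
by move=> h /(le_lt_trans h); rewrite ltxx.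
Qed.

Lemma qpoch_infD (x : C) N :
  qpoch_inf q x = qpoch q x N * qpoch_inf q (x * q ^+ N).
Proof.
apply: cvg_lim; first exact: norm_hausdorff.
rewrite -(cvg_shiftn N).
have -> : [sequence qpoch q x (n + N)%N]_n =
    (fun n => qpoch q x N * qpoch q (x * q ^+ N) n).
  by apply/funext => n; rewrite /= addnC qpochD.
by apply: cvgMr; exact: cvg_qpoch.
Qed.

End Bounds.

(** * Growth of q-differences *)

Section Growth.
Variable R : realType.
Local Notation C := (Cplx R).
Variable q : C.
Hypothesis q01 : 0 < q < 1.
Let qX0 := qX_neq0 q01.
Let qge0 := q_ge0 q01.
Let qXge0 n : 0 <= q ^+ n. Proof. exact: exprn_ge0. Qed.
Let qXle1 n : q ^+ n <= 1. Proof. by rewrite exprn_ile1 // ltW //; case/andP: q01. Qed.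
Let qVge0 n : 0 <= q ^- n. Proof. by rewrite invr_ge0. Qed.

(** The decay q^(i n) in the position i is essential: in the q-Leibniz rule it
    compensates the growth q^-(k (n-k)) of the coefficients. *)
Definition qsmooth (s : C) (u : nat -> C) := exists2 c : C, 0 <= c &
  forall n i, `|qdiff q n u i| <= c * s ^+ n * q ^+ (i * n).

Lemma leibniz_coef_bounded : exists2 B : C, 0 <= B &
  forall k l, `|leibniz_coef q (k + l) k| <= B * q ^- (k * l).
Proof.
have [E E0 EP] := qpoch_bounded q01 q.
have [F F0 FP] : exists2 F : C, 0 < F & forall n, `|(qpoch q q n)^-1| <= F.
  by apply: qpochV_bounded => //; rewrite ger0_norm //; case/andP: q01.
exists (E * (F * F)) => [|k l]; first by rewrite !mulr_ge0 // ltW.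
rewrite leibniz_coefE // -mulrA normrM (ger0_norm (qVge0 _)).
rewrite [X in _ <= X]mulrC ler_wpM2l //.
by rewrite normrM invfM normrM !ler_pM // mulr_ge0.
Qed.

(** The bound on [u] is asked for k <= n only, so that [u] may depend on n. *)
Lemma qdiffM_le : exists2 B : C, 0 <= B &
  forall (u v : nat -> C) (x : nat -> C) (s c S : C) n i, 0 <= s -> 0 <= c ->
  (forall k, 0 <= x k) -> \sum_(k < n.+1) x k <= S ->
  (forall k j, (k <= n)%N -> `|qdiff q k u j| <= x k * s ^+ k * q ^+ (j * k)) ->
  (forall k j, `|qdiff q k v j| <= c * s ^+ k * q ^+ (j * k)) ->
  `|qdiff q n (fun k => u k * v k) i| <= B * S * c * s ^+ n * q ^+ (i * n).
Proof.
have [B B0 BP] := leibniz_coef_bounded; exists B => //.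
move=> u v x s c S n i s0 c0 x0 xS uP vP.
rewrite qdiffM //; apply: le_trans (ler_norm_sum _ _ _) _.
apply: (@le_trans _ _ (\sum_(k < n.+1) B * x k * c * s ^+ n * q ^+ (i * n))); last first.
  rewrite -!mulr_suml -mulr_sumr.
  by rewrite !ler_wpM2r ?exprn_ge0 // ler_wpM2l.
apply: ler_sum => -[k kn] _ /=; rewrite ltnS in kn.
rewrite !normrM.
have := BP k (n - k)%N; rewrite subnKC // => h.
apply: le_trans (ler_pM _ _ h (ler_pM _ _ (uP k _ kn) (vP _ i))) _; rewrite ?mulr_ge0 //.
rewrite le_eqVlt; apply/orP; left; apply/eqP.
have -> : s ^+ n = s ^+ k * s ^+ (n - k) by rewrite -exprD subnKC.
have -> : q ^+ (i * n) = q ^+ (i * k) * q ^+ (i * (n - k)).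
  by rewrite -exprD -mulnDr subnKC.
rewrite mulnDl exprD [((n - k) * k)%N]mulnC.
have := qX0 (k * (n - k)); move: (q ^+ (k * (n - k))) (s ^+ k) (s ^+ (n - k)) => y t1 t2.
by move: (q ^+ (i * k)) (q ^+ (i * (n - k))) => z1 z2 y0; field.
Qed.

Lemma sum_expr_le (t : C) n : 0 <= t -> t < 1 -> \sum_(k < n) t ^+ k <= (1 - t)^-1.
Proof.
move=> t0 t1; rewrite -[X in _ <= X]mul1r ler_pdivlMr ?subr_gt0 // mulrC.
by rewrite -opprB mulNr -subrX1 opprB gerBl exprn_ge0.
Qed.

(** The left side collects some of the terms of the expanded product on the
    right. *)
Lemma sum_prod_le (y : C) n : 0 <= y ->
  \sum_(k < n.+1) \prod_(j < k) (y * q ^+ j) <= qpoch q (- y) n.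
Proof.
move=> y0; have yq j : 0 <= y * q ^+ j by rewrite mulr_ge0.
have H m : \prod_(j < m) (y * q ^+ j) <= qpoch q (- y) m.
  apply: ler_prod => j _; rewrite yq /= mulNr opprK.
  by rewrite lerDr.
elim: n => [|n IH]; first by rewrite big_ord_recl big_ord0 /= big_ord0 addr0 qpoch0.
rewrite big_ord_recr qpochS mulNr opprK mulrDr mulr1 lerD //=.
by rewrite big_ord_recr ler_wpM2r.
Qed.

Lemma qsmooth1 (s : C) : 0 <= s -> qsmooth s (fun=> 1).
Proof.
move=> s0; exists 1 => // n i.
have E : (fun=> 1) =1 qpoch q (0 : C).
  by move=> k; rewrite /qpoch big1 // => j _; rewrite mul0r subr0.
rewrite (eq_qdiff _ _ _ E) qdiff_qpoch // -E mul0r !mul1r.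
case: n => [|n]; first by rewrite muln0 !expr0 mulr1 normr1.
by rewrite expr0n normr0 mulr_ge0 ?exprn_ge0.
Qed.

Lemma qsmoothM_qpoch (s A : C) v : `|A| < s -> qsmooth s v ->
  qsmooth s (fun k => qpoch q A k * v k).
Proof.
move=> As [c c0 vP]; have [E E0 EP] := qpoch_bounded q01 A.
have s0 : 0 < s by apply: le_lt_trans As.
have [B B0 BP] := qdiffM_le.
have t1 : `|A| / s < 1 by rewrite ltr_pdivrMr // mul1r.
have t0 : 0 <= `|A| / s by rewrite divr_ge0 // ltW.
exists (B * (E * (1 - `|A| / s)^-1) * c).
  by rewrite !mulr_ge0 // invr_ge0 subr_ge0 ltW.
move=> n i; apply: (BP _ _ (fun k => E * (`|A| / s) ^+ k)) => //; first exact: ltW.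
- by move=> k; rewrite mulr_ge0 ?exprn_ge0.
- by rewrite -mulr_sumr ler_wpM2l // sum_expr_le.
move=> k j _; rewrite qdiff_qpoch // normrM normrX normrM (ger0_norm (qXge0 j)).
rewrite [(_ * q ^+ j) ^+ k]exprMn -exprM -[E * _ * _]mulrA -exprMn divfK ?lt0r_neq0 //.
by rewrite mulrA !ler_wpM2r ?exprn_ge0.
Qed.

Lemma qsmoothM_qpochV (s B : C) v : 0 < s -> `|B| < 1 -> qsmooth s v ->
  qsmooth s (fun k => (qpoch q B k)^-1 * v k).
Proof.
move=> s0 B1 [c c0 vP]; have [E /ltW E0 EP] := qpochV_bounded q01 B1.
have [L L0 LP] := qdiffM_le.
have y0 : 0 <= `|B| / s by rewrite divr_ge0 // ltW.
have [F F0 FP] := qpochN_bounded q01 y0.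
exists (L * (E * F) * c); first by rewrite !mulr_ge0.
move=> n i; apply: (LP _ _ (fun k => E * \prod_(j < k) (`|B| / s * q ^+ j))) => //.
- exact: ltW.
- by move=> k; rewrite mulr_ge0 // prodr_ge0 // => j _; rewrite mulr_ge0.
- by rewrite -mulr_sumr ler_wpM2l // (le_trans (sum_prod_le _ y0)).
move=> k j _; rewrite qdiff_inv_qpoch //; last by move=> l; exact: subr1_qX_neq0.
rewrite [_ / _]mulrC mulrA normrM (ger0_norm (qXge0 _)) ler_wpM2r //.
rewrite normrM -mulrA ler_pM //.
rewrite -[X in s ^+ X]card_ord -prodr_const -big_split normr_prod /=.
apply: ler_prod => l _; rewrite normr_ge0 /= normrN normrM (ger0_norm (qXge0 l)).
by rewrite mulrAC divfK ?lt0r_neq0.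
Qed.

(** The n-th difference of (al q^n; q)_k v_k.  For k <= n one has
    q^(n k) <= prod_(j < k) q^j, so the k-th differences of the moving factor
    are dominated by quantities that do not depend on n and have a finite sum,
    however large |al| / s is. *)
Lemma qdiff_moving_bounded (s al : C) v : 0 < s -> qsmooth s v ->
  exists2 D : C, 0 <= D & forall n,
    `|qdiff q n (fun k => qpoch q (al * q ^+ n) k * v k) 0| <= D * s ^+ n.
Proof.
move=> s0 [c c0 vP].
have [E E0 EP] := qpochN_bounded q01 (normr_ge0 al).
have [L L0 LP] := qdiffM_le.
have y0 : 0 <= `|al| / s by rewrite divr_ge0 // ltW.
have [F F0 FP] := qpochN_bounded q01 y0.
exists (L * (E * F) * c) => [|n]; first by rewrite !mulr_ge0.
rewrite -[X in _ <= X]mulr1 -(expr0 q) -(mul0n n).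
apply: (LP _ _ (fun k => E * \prod_(j < k) (`|al| / s * q ^+ j))) => //.
- exact: ltW.
- by move=> k; rewrite mulr_ge0 // prodr_ge0 // => j _; rewrite mulr_ge0.
- by rewrite -mulr_sumr ler_wpM2l // (le_trans (sum_prod_le _ y0)).
move=> k j kn; rewrite qdiff_qpoch // exprMn -exprM mulrA normrM (ger0_norm (qXge0 _)).
rewrite ler_wpM2r // normrM -mulrA ler_pM //.
  apply: le_trans (ler_norm_qpoch q01 _ _) _; apply: le_trans (EP j).
  apply: ler_prod => l _; rewrite !mulNr !opprK addr_ge0 ?mulr_ge0 //=.
  by rewrite lerD2l ler_wpM2r // normrM (ger0_norm (qXge0 n)) ler_piMr.
rewrite -[X in _ * s ^+ X]card_ord -prodr_const -big_split /=.
rewrite normrX normrM (ger0_norm (qXge0 n)) -[X in _ ^+ X]card_ord -prodr_const.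
apply: ler_prod => -[l lk] _ /=; rewrite mulr_ge0 //= mulrAC divfK ?lt0r_neq0 //.
rewrite ler_wpM2l // ler_wiXn2l //; first by case/andP: q01 => _ /ltW.
exact: ltnW (leq_trans lk kn).
Qed.

End Growth.

(** * Majorant norms and the identity principle *)

Section Majorant.
Variables (K : numFieldType) (rho : K).
Hypothesis rho_ge0 : 0 <= rho.
Implicit Types p : {poly K}.

(** The weighted norm sum_i |p_i| rho^i, as the value at rho of the polynomial
    with coefficients |p_i|: its properties follow by comparing coefficients. *)
Definition majorant p : K := (map_poly Num.norm p).[rho].

Lemma coef_norm p i : (map_poly Num.norm p)`_i = `|p`_i|.
Proof. by rewrite coef_map_id0 ?normr0. Qed.

Lemma ler_horner_coef p1 p2 : (forall i, p1`_i <= p2`_i) -> p1.[rho] <= p2.[rho].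
Proof.
move=> p12.
rewrite (@horner_coef_wide _ (maxn (size p1) (size p2)) p1) ?leq_maxl //.
rewrite (@horner_coef_wide _ (maxn (size p1) (size p2)) p2) ?leq_maxr //.
by apply: ler_sum => i _; rewrite ler_wpM2r ?exprn_ge0.
Qed.

Lemma majorant_ge0 p : 0 <= majorant p.
Proof.
rewrite /majorant horner_coef sumr_ge0 // => i _.
by rewrite coef_norm mulr_ge0 ?exprn_ge0.
Qed.

Lemma majorantD p1 p2 : majorant (p1 + p2) <= majorant p1 + majorant p2.
Proof.
rewrite /majorant -hornerD; apply: ler_horner_coef => i.
by rewrite coefD !coef_norm coefD ler_normD.
Qed.

Lemma majorantN p : majorant (- p) = majorant p.
Proof.
by rewrite /majorant; congr _.[_]; apply/polyP => i; rewrite !coef_norm coefN normrN.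
Qed.

Lemma majorantB p1 p2 : majorant (p1 - p2) <= majorant p1 + majorant p2.
Proof. by rewrite -(majorantN p2) majorantD. Qed.

Lemma majorantM p1 p2 : majorant (p1 * p2) <= majorant p1 * majorant p2.
Proof.
rewrite /majorant -hornerM; apply: ler_horner_coef => i.
rewrite coef_norm !coefM (le_trans (ler_norm_sum _ _ _)) //.
by apply: ler_sum => j _; rewrite normrM !coef_norm.
Qed.

Lemma majorantC c : majorant c%:P = `|c|.
Proof.
rewrite /majorant (_ : map_poly _ _ = `|c|%:P) ?hornerC //.
by apply/polyP => i; rewrite coef_norm !coefC; case: ifP; rewrite ?normr0.
Qed.

Lemma majorantXn n : majorant 'X^n = rho ^+ n.
Proof.
rewrite /majorant (_ : map_poly _ _ = 'X^n) ?hornerXn //.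
by apply/polyP => i; rewrite coef_norm coefXn normr_nat.
Qed.

Lemma majorantMXn p n : majorant (p * 'X^n) = majorant p * rho ^+ n.
Proof.
rewrite /majorant -[rho ^+ n]hornerXn -hornerM; congr _.[_]; apply/polyP => i.
by rewrite coef_norm !coefMXn coef_norm; case: ifP; rewrite ?normr0.
Qed.

Lemma majorant_linear (c : K) : majorant (1 - c *: 'X) <= 1 + `|c| * rho.
Proof.
apply: le_trans (majorantB _ _) _.
rewrite -mul_polyC -['X]expr1 majorantMXn !majorantC normr1 expr1 //.
Qed.

Lemma ler_norm_horner p z : `|z| <= rho -> `|p.[z]| <= majorant p.
Proof.
move=> zr; rewrite /majorant horner_coef.
rewrite (@horner_coef_wide _ (size p)); last exact: size_poly.
apply: le_trans (ler_norm_sum _ _ _) _; apply: ler_sum => i _.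
by rewrite coef_norm normrM normrX ler_wpM2l // lerXn2r ?nnegrE.
Qed.

Lemma majorant_drop p n : majorant (drop_poly n p * 'X^n) <= majorant p.
Proof.
apply: ler_horner_coef => i; rewrite !coef_norm coefMXn.
case: ltnP => [_|ni]; first by rewrite normr0.
by rewrite coef_drop_poly subnK.
Qed.

End Majorant.

Section Identity.
Variable R : realType.
Local Notation C := (Cplx R).
Variables q rho theta : C.
Hypothesis q01 : 0 < q < 1.
Hypothesis rho_gt0 : 0 < rho.
Hypothesis q_theta : q <= theta.
Hypothesis theta_lt1 : theta < 1.
Let rho_ge0 : 0 <= rho. Proof. exact: ltW. Qed.
Let q_gt0 := q_gt0 q01.
Let theta_gt0 : 0 < theta. Proof. exact: lt_le_trans q_theta. Qed.
Let theta_ge0 : 0 <= theta. Proof. exact: ltW. Qed.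
Let thX0 n : 0 <= theta ^+ n. Proof. exact: exprn_ge0. Qed.
Local Notation N := (majorant rho).
Let N0 := majorant_ge0 rho_ge0.
Let qXge0 n : 0 <= q ^+ n. Proof. by rewrite exprn_ge0 // ltW. Qed.
Let qX_theta n : q ^+ n <= theta ^+ n.
Proof. by rewrite lerXn2r ?nnegrE // ltW. Qed.

(** The rate theta is common to all sequences, which keeps products and
    differences within the class. *)
Definition geometric_cauchy (p : nat -> {poly C}) := exists2 D : C, 0 <= D &
  forall n, N (p n) <= D /\ N (p n.+1 - p n) <= D * theta ^+ n.

Lemma geometric_cauchyM p1 p2 : geometric_cauchy p1 -> geometric_cauchy p2 ->
  geometric_cauchy (fun n => p1 n * p2 n).
Proof.
move=> [D1 D10 P1] [D2 D20 P2]; exists (D1 * D2 *+ 2) => [|n].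
  by rewrite mulrn_wge0 // mulr_ge0.
have [a1 b1] := P1 n; have [a2 b2] := P2 n; have [a1' _] := P1 n.+1.
have D12 : 0 <= D1 * D2 by rewrite mulr_ge0.
split.
  rewrite (le_trans (majorantM rho_ge0 _ _)) // (le_trans (ler_pM _ _ a1 a2)) //.
  by rewrite mulr2n lerDl.
have -> : p1 n.+1 * p2 n.+1 - p1 n * p2 n =
    p1 n.+1 * (p2 n.+1 - p2 n) + (p1 n.+1 - p1 n) * p2 n by ring.
rewrite (le_trans (majorantD rho_ge0 _ _)) // mulrnAl mulr2n.
rewrite lerD // (le_trans (majorantM rho_ge0 _ _)) //.
  by rewrite -mulrA ler_pM.
by rewrite mulrAC ler_pM.
Qed.

Lemma geometric_cauchyB p1 p2 : geometric_cauchy p1 -> geometric_cauchy p2 ->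
  geometric_cauchy (fun n => p1 n - p2 n).
Proof.
move=> [D1 D10 P1] [D2 D20 P2]; exists (D1 + D2) => [|n]; first exact: addr_ge0.
have [a1 b1] := P1 n; have [a2 b2] := P2 n.
split; first by rewrite (le_trans (majorantB rho_ge0 _ _)) // lerD.
have -> : p1 n.+1 - p2 n.+1 - (p1 n - p2 n) =
  (p1 n.+1 - p1 n) - (p2 n.+1 - p2 n) by ring.
by rewrite (le_trans (majorantB rho_ge0 _ _)) // mulrDl lerD.
Qed.

Lemma geometric_cauchyC c : geometric_cauchy (fun=> c%:P).
Proof.
exists `|c| => // n; rewrite subrr majorantC; split=> //.
by rewrite -[0]/(0%:P) majorantC normr0 mulr_ge0.
Qed.

Lemma geometric_cauchy_prod (I : Type) (r : seq I) (p : I -> nat -> {poly C}) :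
  (forall i, geometric_cauchy (p i)) ->
  geometric_cauchy (fun n => \prod_(i <- r) p i n).
Proof.
move=> pP; elim: r => [|i r IH].
  rewrite (_ : (fun _ => _) = fun=> 1%:P); first exact: geometric_cauchyC.
  by apply/funext => n; rewrite big_nil.
rewrite (_ : (fun _ => _) = fun n => p i n * \prod_(j <- r) p j n).
  exact: geometric_cauchyM.
by apply/funext => n; rewrite big_cons.
Qed.

Definition qpoch_poly (c : C) n : {poly C} := \prod_(k < n) (1 - (c * q ^+ k) *: 'X).

Lemma horner_qpoch_poly c n z : (qpoch_poly c n).[z] = qpoch q (c * z) n.
Proof.
rewrite /qpoch_poly horner_prod; apply: eq_bigr => k _.
by rewrite hornerD hornerN hornerZ hornerX hornerC mulrAC.
Qed.

Lemma majorant_factor c n : N (1 - (c * q ^+ n) *: 'X) <= 1 - - (`|c| * rho) * q ^+ n.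
Proof.
apply: le_trans (majorant_linear rho_ge0 _) _.
by rewrite normrM (ger0_norm (qXge0 n)) mulNr opprK mulrAC.
Qed.

(** The recursion met by (c z; q)_n times the n-th partial sum of a series whose
    k-th term is d_k / (c z; q)_k.  Without the terms [d n] it is the one for
    (c z; q)_n itself. *)
Lemma geometric_cauchy_rec c (p d : nat -> {poly C}) D : 0 <= D ->
  (forall n, N (d n) <= D * theta ^+ n) ->
  (forall n, p n.+1 = (p n + d n) * (1 - (c * q ^+ n) *: 'X)) ->
  geometric_cauchy p.
Proof.
move=> D0 dD pS; pose y := `|c| * rho.
have y0 : 0 <= y by rewrite mulr_ge0.
have [E E0 EP] := qpochN_bounded q01 y0.
pose S := N (p 0%N) + D / (1 - theta).
have S0 : 0 <= S by rewrite addr_ge0 // divr_ge0 // subr_ge0 ltW.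
have H n : N (p n) <= qpoch q (- y) n * (N (p 0%N) + \sum_(k < n) D * theta ^+ k).
  elim: n => [|n IH]; first by rewrite qpoch0 big_ord0 addr0 mul1r.
  rewrite pS (le_trans (majorantM rho_ge0 _ _)) // qpochS mulrAC ler_pM //.
    rewrite (le_trans (majorantD rho_ge0 _ _)) // big_ord_recr addrA mulrDr lerD //=.
    apply: le_trans (dD n) _; rewrite ler_peMl ?mulr_ge0 //.
    exact: qpochN_ge1.
  exact: majorant_factor.
have HS n : N (p n) <= E * S.
  apply: le_trans (H n) _; apply: ler_pM => //.
  - exact: le_trans (qpochN_ge1 q01 n y0).
  - by rewrite addr_ge0 // sumr_ge0 // => k _; rewrite mulr_ge0.
  - by rewrite lerD2l -mulr_sumr ler_wpM2l // sum_expr_le.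
have T0 : 0 <= D * (1 + y) + E * S * y.
  by do ! (apply: addr_ge0 || apply: mulr_ge0) => //.
exists (E * S + (D * (1 + y) + E * S * y)) => [|n].
  by rewrite addr_ge0 // mulr_ge0.
split; first by rewrite (le_trans (HS n)) // lerDl.
have -> : p n.+1 - p n = d n * (1 - (c * q ^+ n) *: 'X) - p n * ((c * q ^+ n)%:P * 'X^1).
  by rewrite pS -mul_polyC expr1; ring.
apply: le_trans (majorantB rho_ge0 _ _) _.
apply: (@le_trans _ _ ((D * (1 + y) + E * S * y) * theta ^+ n)); last first.
  by rewrite ler_wpM2r // lerDr mulr_ge0.
rewrite mulrDl lerD // (le_trans (majorantM rho_ge0 _ _)) //.
  rewrite [D * _ * _]mulrAC ler_pM // (le_trans (majorant_factor c n)) //.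
  rewrite mulNr opprK lerD2l ler_piMr //.
  by rewrite exprn_ile1 // ltW //; case/andP: q01.
rewrite majorantMXn majorantC expr1 -[E * S * y * _]mulrA ler_pM ?mulr_ge0 //.
by rewrite normrM (ger0_norm (qXge0 n)) mulrAC ler_wpM2l.
Qed.

Lemma geometric_cauchy_qpoch c : geometric_cauchy (qpoch_poly c).
Proof.
apply: (@geometric_cauchy_rec c _ (fun=> 0) 0) => // n.
  by rewrite -[0]/(0%:P) majorantC normr0 mul0r.
by rewrite addr0 /qpoch_poly big_ord_recr.
Qed.

Lemma horner_split (p : {poly C}) n z :
  p.[z] = \sum_(i < n) p`_i * z ^+ i + (drop_poly n p * 'X^n).[z].
Proof. by rewrite -{1}(poly_take_drop n p) hornerD /take_poly horner_poly. Qed.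

Lemma geometric_cauchy_tail p : geometric_cauchy p -> exists2 D : C, 0 <= D &
  forall n k, N (p (n + k)%N - p n) <= D * theta ^+ n.
Proof.
move=> [D D0 DP]; exists (D / (1 - theta)); first by rewrite divr_ge0 // subr_ge0 ltW.
move=> n k; apply: (@le_trans _ _ (D * theta ^+ n * \sum_(l < k) theta ^+ l)); last first.
  by rewrite [D / _ * _]mulrAC ler_wpM2l ?mulr_ge0 // sum_expr_le.
elim: k => [|k IH].
  by rewrite addn0 subrr big_ord0 mulr0 -[0]/(0%:P) majorantC normr0.
have -> : p (n + k.+1)%N - p n = (p (n + k)%N - p n) + (p (n + k).+1 - p (n + k)%N).
  by rewrite addnS; ring.
rewrite (le_trans (majorantD rho_ge0 _ _)) // big_ord_recr mulrDr lerD //=.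
by have [_] := DP (n + k)%N; rewrite exprD mulrA.
Qed.

Lemma cvg_sum_coef0 (p : nat -> {poly C}) n z :
  (forall i, (i < n)%N -> (fun m => (p m)`_i) @ \oo --> (0 : C)) ->
  (fun m => \sum_(i < n) (p m)`_i * z ^+ i) @ \oo --> (0 : C).
Proof.
move=> p0; rewrite [X in _ --> X](_ : 0 = \sum_(i < n) (0 : C)); last by rewrite big1.
apply: cvg_big => [|i _]; first exact: add_continuous.
by rewrite -[X in _ --> X](mul0r (z ^+ i)); apply: cvgMl; exact: p0.
Qed.

(** Once the coefficients below j are known to vanish in the limit, dividing
    the value at z by z^j isolates the j-th coefficient up to an error O(|z|),
    uniform in n because the majorant norms are bounded. *)
Lemma cvg_coef_identity p j : geometric_cauchy p ->
  (forall e : C, 0 < e -> exists z : C,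
     [/\ z != 0, `|z| < e, `|z| <= rho & (fun n => (p n).[z]) @ \oo --> (0 : C)]) ->
  (fun n => (p n)`_j) @ \oo --> (0 : C).
Proof.
move=> [D D0 DP] pz; elim/ltn_ind: j => j IH.
apply/cvgrPdist_lt => e e0; have e20 : 0 < e / 2 by rewrite divr_gt0.
pose B := D / rho ^+ j.+1; have B0 : 0 <= B by rewrite divr_ge0 ?exprn_ge0.
have [|z [z0 ze zr pz0]] := pz (e / 2 / (B + 1)); first by rewrite divr_gt0 // ltr_wpDl.
have zX n : z ^+ n != 0 by rewrite expf_neq0.
have : (fun n => z ^- j * ((p n).[z] - \sum_(i < j) (p n)`_i * z ^+ i)) @ \oo --> (0 : C).
  rewrite -[X in _ --> X](mulr0 (z ^- j)); apply: cvgMr.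
  rewrite -[X in _ --> X](subr0 0); apply: cvgB => //.
  by apply: cvg_sum_coef0 => i; exact: IH.
move/cvgrPdist_lt/(_ _ e20) => pe; near=> n.
have : `|0 - z ^- j * ((p n).[z] - \sum_(i < j) (p n)`_i * z ^+ i)| < e / 2 by near: n.
rewrite !sub0r !normrN (horner_split (p n) j.+1 z) big_ord_recr /= hornerM hornerXn.
set a := (p n)`_j; set d := _.[z]; set S := \sum_(i < j) _.
have -> : z ^- j * (S + a * z ^+ j + d * z ^+ j.+1 - S) = a + d * z.
  by rewrite exprSr; field.
move=> ae; have -> : a = (a + d * z) - d * z by ring.
rewrite (le_lt_trans (ler_normB _ _)) // (splitr e) ltr_leD // normrM.
have dB : `|d| <= B.
  rewrite /B ler_pdivlMr ?exprn_gt0 //; have [Np _] := DP n.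
  apply: le_trans (le_trans (majorant_drop rho_ge0 (p n) j.+1) Np).
  by rewrite majorantMXn // ler_wpM2r ?exprn_ge0 //; exact: ler_norm_horner.
move: (ltW ze); rewrite ler_pdivlMr ?ltr_wpDl // mulrC; apply: le_trans.
by rewrite ler_wpM2r // (le_trans dB) // lerDl.
Unshelve. all: by end_near. Qed.

(** Beyond the degree of [p n], the later polynomials differ from 0 by at most
    the tail of the Cauchy sequence; below it, finitely many coefficients tend
    to 0. *)
Theorem identity_principle p : geometric_cauchy p ->
  (forall e : C, 0 < e -> exists z : C,
     [/\ z != 0, `|z| < e, `|z| <= rho & (fun n => (p n).[z]) @ \oo --> (0 : C)]) ->
  forall a : C, `|a| <= rho -> (fun n => (p n).[a]) @ \oo --> (0 : C).
Proof.
move=> pG pz a ar; have [D D0 DP] := geometric_cauchy_tail pG.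
apply/cvgrPdist_lt => e e0; have e20 : 0 < e / 2 by rewrite divr_gt0.
have [n hn] : exists n, theta ^+ n < e / 2 / (D + 1).
  have e1 : 0 < e / 2 / (D + 1) by rewrite divr_gt0 // ltr_wpDl.
  have /cvgrPdist_lt/(_ _ e1)[n _ /(_ n (leqnn n))] :
      (fun n => theta ^+ n) @ \oo --> (0 : C).
    by apply: cvg_exprn0; rewrite ger0_norm.
  by rewrite /= sub0r normrN ger0_norm // => h; exists n.
have /cvgrPdist_lt/(_ _ e20) ps :
    (fun m => \sum_(i < size (p n)) (p m)`_i * a ^+ i) @ \oo --> (0 : C).
  by apply: cvg_sum_coef0 => i _; exact: cvg_coef_identity.
near=> m; have nm : (n <= m)%N by near: m; exact: nbhs_infty_ge.
rewrite sub0r normrN (horner_split (p m) (size (p n)) a).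
rewrite (le_lt_trans (ler_normD _ _)) // (splitr e) ltr_leD //.
  by rewrite -normrN -sub0r; near: m.
have -> : drop_poly (size (p n)) (p m) = drop_poly (size (p n)) (p m - p n).
  apply/polyP => i; rewrite !coef_drop_poly coefB.
  by rewrite [X in _ - X]nth_default ?subr0 // leq_addl.
apply: le_trans (ler_norm_horner rho_ge0 _ ar) _.
apply: le_trans (majorant_drop rho_ge0 _ _) _.
rewrite -(subnKC nm); apply: le_trans (DP n (m - n)%N) _.
have h : theta ^+ n * (D + 1) <= e / 2 by rewrite -ler_pdivlMr ?ltr_wpDl // ltW.
by apply: le_trans h; rewrite mulrC ler_wpM2l // lerDl.
Unshelve. all: by end_near. Qed.

End Identity.

(** * The expansion *)

Lemma exists_between_seq (K : numFieldType) (y : K) (r : seq K) : 0 < y ->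
  all (fun x => 0 <= x < y) r -> exists t : K, 0 < t < y /\ all (fun x => x < t) r.
Proof.
move=> y0; elim: r => [_|x r IH /= /andP[/andP[x0 xy] /IH[t [/andP[t0 ty] rt]]]].
  by exists (y / 2); rewrite divr_gt0 // ltr_pdivrMr // mulr_natr mulr2n ltrDl.
case: (real_ltP (ger0_real x0) (gtr0_real t0)) => xt.
  by exists t; rewrite t0 ty xt rt.
have h1 : x < (x + y) / 2 by rewrite ltr_pdivlMr // mulr_natr mulr2n ltrD2l.
have h2 : (x + y) / 2 < y by rewrite ltr_pdivrMr // mulr_natr mulr2n ltrD2r.
exists ((x + y) / 2); rewrite h1 h2 (le_lt_trans x0 h1); split=> //=.
by apply/allP => z /(allP rt) zt; rewrite (lt_trans zt) // (le_lt_trans xt).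
Qed.

Lemma node_identity (K : fieldType) (x y b1 b2 c1 c2 d1 d2 : K) :
  b1 != 0 -> b2 != 0 -> d1 != 0 -> d2 != 0 ->
  x * (y * (b1^-1 * (c1 / d1))) * c2 =
  y * x / (b1 * b2) * (c1 * c2 / (d1 * d2)) * (b2 * d2).
Proof. by move=> b10 b20 d10 d20; field; rewrite b10 b20 d10 d20. Qed.

Lemma regroup_fractions (K : fieldType) (x b1 c1 b2 y b3 a1 c3 : K) :
  x / b1 * (c1 / b2) * (y * b3) / (a1 * c3) =
  x * y / (a1 * b1) * (b3 * c1 / (c3 * b2)).
Proof. by rewrite !invfM; ring. Qed.

Lemma qpochs_inf_pair (K : numFieldType) (q x y : K) :
  qpochs_inf q [:: x; y] = qpoch_inf q x * qpoch_inf q y.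
Proof. by rewrite /qpochs_inf !big_cons big_nil mulr1. Qed.

Section Expansion.
Variable R : realType.
Local Notation C := (Cplx R).
Variables (q : C) (m : nat) (al a b : C) (bs cs : 'I_m -> C).
Hypothesis q01 : 0 < q < 1.
Hypothesis ala1 : `|al * a| < 1.
Hypothesis alb1 : `|al * b| < 1.
Hypothesis albs1 : forall j, `|al * bs j| < 1.
Hypothesis acs1 : forall j, `|al * a * cs j / q| < 1.
Let q0 := q_neq0 q01.
Let qgt0 := q_gt0 q01.
Let qge0 := q_ge0 q01.
Let qXge0 n : 0 <= q ^+ n. Proof. exact: exprn_ge0. Qed.

Let qXle1 n : q ^+ n <= 1. Proof. by rewrite exprn_ile1 // ltW //; case/andP: q01. Qed.

(** The numbers G_k; the parameter b enters just as the b_j do. *)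
Definition node_value k : C :=
  (qpoch q (al * b) k)^-1 * \prod_(j < m) (qpoch q (al * cs j) k / qpoch q (al * bs j) k).

Definition inner n : C := qdiff q n (fun k => qpoch q (al * q ^+ n) k * node_value k) 0.

Lemma bhs_inner n :
  bhs [tuple of q ^- n :: al * q ^+ n :: [tuple al * cs j | j < m]]
      [tuple of al * b :: [tuple al * bs j | j < m]] q q = inner n.
Proof.
rewrite (@bhs_terminates _ _ _ _ _ _ n) ?inE ?eqxx //.
rewrite /inner qdiffE //; apply: eq_bigr => k _; rewrite add0n.
rewrite /bhs_term /qpochs /= !big_cons !big_map -!enumT /= !big_enum /=.
rewrite /qdiff_coef /node_value prodf_div !invfM; ring.
Qed.

Lemma qsmooth_node_value s : 0 < s -> (forall j, `|al * cs j| < s) ->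
  qsmooth q s node_value.
Proof.
move=> s0 css; apply: qsmoothM_qpochV => //.
elim: (index_enum _) => [|j r IH].
  rewrite (_ : (fun _ => _) = fun=> 1); first by apply: qsmooth1 => //; exact: ltW.
  by apply/funext => k; rewrite big_nil.
rewrite (_ : (fun _ => _) = fun k => qpoch q (al * cs j) k *
  ((qpoch q (al * bs j) k)^-1 *
   \prod_(i <- r) (qpoch q (al * cs i) k / qpoch q (al * bs i) k))).
  by apply: qsmoothM_qpoch => //; exact: qsmoothM_qpochV.
by apply/funext => k; rewrite big_cons mulrA.
Qed.

(** For a = 0 the radius |a| is not allowed, since the identity principle needs
    a disc that contains nodes. *)
Lemma exists_radius : exists rho : C,
  [/\ 0 < rho, `|a| <= rho, `|al| * rho < 1 & forall j, `|al * cs j| * rho < q].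
Proof.
have [a0|a0] := eqVneq a 0; last first.
  exists `|a|; rewrite normr_gt0 a0 -normrM; split=> // j.
  have := acs1 j; rewrite normrM normfV (ger0_norm qge0) ltr_pdivrMr // mul1r.
  by rewrite -normrM mulrAC.
pose M := 1 + `|al| + \sum_(j < m) `|al * cs j| / q.
have S0 : 0 <= \sum_(j < m) `|al * cs j| / q.
  by apply: sumr_ge0 => j _; rewrite divr_ge0.
have M0 : 0 < M by rewrite /M -addrA ltr_wpDr // addr_ge0.
exists M^-1; split.
- by rewrite invr_gt0.
- by rewrite a0 normr0 invr_ge0 ltW.
- by rewrite ltr_pdivrMr // mul1r /M -addrA addrCA ltrDl ltr_wpDr.
move=> j; rewrite ltr_pdivrMr // [q * M]mulrC -ltr_pdivrMr //.
rewrite /M (bigD1 j) //= addrCA ltrDl.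
have P : 0 < 1 + `|al| by rewrite ltr_wpDr.
by rewrite ltr_wpDr //; apply: sumr_ge0 => i _; rewrite divr_ge0.
Qed.

(** The rate s rho / q of the outer series is also made at least q, the rate at
    which the infinite products converge. *)
Lemma exists_rate (rho : C) : 0 < rho -> (forall j, `|al * cs j| * rho < q) ->
  exists s : C, [/\ 0 < s, forall j, `|al * cs j| < s,
    q <= s * rho / q & s * rho / q < 1].
Proof.
move=> rho0 csr.
have qr0 : 0 < q / rho by rewrite divr_gt0.
have [||s [/andP[s0 sqr] /= /andP[qs /allP css]]] :=
  @exists_between_seq C (q / rho) (q * q / rho :: [seq `|al * cs j| | j <- enum 'I_m]) => //.
  rewrite /= divr_ge0 ?mulr_ge0 ?(ltW rho0) //= ltr_pM2r ?invr_gt0 //.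
  rewrite gtr_pMr //; case/andP: q01 => _ -> /=; apply/allP => _ /mapP[j _ ->].
  by rewrite normr_ge0 ltr_pdivlMr ?csr.
exists s; split=> //.
- by move=> j; apply: css; apply/mapP; exists j; rewrite ?mem_enum.
- by rewrite ler_pdivlMr // -ler_pdivrMr // ltW.
- by rewrite ltr_pdivrMr // mul1r -ltr_pdivlMr.
Qed.

Definition shift_poly n : {poly C} := \prod_(k < n) (q^-1 *: ('X - (q ^+ k.+1)%:P)).

Lemma horner_shift_poly n z : (shift_poly n).[z] = qpoch_shift q z n.
Proof.
elim: n => [|n IH]; first by rewrite /shift_poly big_ord0 hornerC qpoch_shift0.
rewrite /shift_poly big_ord_recr hornerM -/(shift_poly n) IH qpoch_shiftS.
by rewrite hornerZ hornerXsubC.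
Qed.

Lemma majorant_shift_poly (rho : C) n : 0 < rho ->
  majorant rho (shift_poly n) <= qpoch q (- (q / rho)) n * (rho / q) ^+ n.
Proof.
move=> rho0; have rge0 := ltW rho0.
elim: n => [|n IH].
  rewrite /shift_poly big_ord0 qpoch0.
  by rewrite -[X in majorant _ X]/(1%:P) majorantC normr1 mulr1.
rewrite /shift_poly big_ord_recr -/(shift_poly n) (le_trans (majorantM _ _ _)) //=.
rewrite qpochS [(rho / q) ^+ _]exprSr mulrACA ler_pM ?majorant_ge0 //.
apply: (@le_trans _ _ (q^-1 * (rho + q ^+ n.+1))).
  rewrite -mul_polyC (le_trans (majorantM _ _ _)) // majorantC normfV (ger0_norm qge0).
  rewrite ler_wpM2l ?invr_ge0 // (le_trans (majorantB _ _ _)) //.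
  by rewrite -['X]expr1 majorantXn majorantC expr1 ger0_norm.
rewrite le_eqVlt; apply/orP; left; apply/eqP; rewrite exprS; field.
by rewrite q0 lt0r_neq0.
Qed.

Lemma vwp_bounded : exists2 E : C, 0 <= E & forall n, `|qpoch_vwp q al n| <= E.
Proof.
have [E E0 EP] := qpoch_bounded q01 (al * q).
exists (1 + (1 + `|al|) * E) => [|[|n]].
- by rewrite addr_ge0 // mulr_ge0 // addr_ge0.
- by rewrite normr1 lerDl mulr_ge0 // addr_ge0.
rewrite /qpoch_vwp normrM ler_wpDl // ler_pM //.
rewrite (le_trans (ler_normB _ _)) // normr1 lerD2l normrM (ger0_norm (qXge0 _)).
by rewrite ler_piMr.
Qed.

Definition term_coef n : C := qpoch_vwp q al n / qpoch q q n * inner n.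

Lemma majorant_term_le (rho s : C) : 0 < rho -> 0 < s -> (forall j, `|al * cs j| < s) ->
  exists2 D : C, 0 <= D & forall n,
    majorant rho (term_coef n *: shift_poly n) <= D * (s * rho / q) ^+ n.
Proof.
move=> rho0 s0 css.
have [V V0 VP] := vwp_bounded.
have [F /ltW F0 FP] : exists2 F : C, 0 < F & forall n, `|(qpoch q q n)^-1| <= F.
  by apply: qpochV_bounded => //; rewrite ger0_norm //; case/andP: q01.
have [D D0 DP] := qdiff_moving_bounded q01 al s0 (qsmooth_node_value s0 css).
have [E E0 EP] := qpochN_bounded q01 (divr_ge0 qge0 (ltW rho0)).
exists (V * F * D * E) => [|n]; first by rewrite !mulr_ge0.
rewrite -mul_polyC (le_trans (majorantM (ltW rho0) _ _)) // majorantC.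
have -> : V * F * D * E * (s * rho / q) ^+ n =
    V * F * (D * s ^+ n) * (E * (rho / q) ^+ n).
  by rewrite -[s * rho / q]mulrA exprMn; ring.
rewrite ler_pM ?(majorant_ge0 (ltW rho0)) //.
  by rewrite /term_coef !normrM !ler_pM // DP.
rewrite (le_trans (majorant_shift_poly n rho0)) // ler_wpM2r // exprn_ge0 //.
by rewrite divr_ge0 // ltW.
Qed.

(** (al a; q)_n times the n-th partial sum of the outer series: a polynomial in
    a, since (al a; q)_k divides (al a; q)_n. *)
Fixpoint partial_poly n : {poly C} :=
  if n is k.+1 then
    (partial_poly k + term_coef k *: shift_poly k) * (1 - (al * q ^+ k) *: 'X)
  else 0.

Definition partial_sum z n :=
  \sum_(k < n) term_coef k * qpoch_shift q z k / qpoch q (al * z) k.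

Lemma horner_partial_poly z n : (forall k, 1 - al * z * q ^+ k != 0) ->
  (partial_poly n).[z] = qpoch q (al * z) n * partial_sum z n.
Proof.
move=> z0; elim: n => [|n IH]; first by rewrite horner0 /partial_sum big_ord0 mulr0.
rewrite /partial_poly -/partial_poly hornerM hornerD IH hornerZ horner_shift_poly.
rewrite hornerD hornerN hornerZ hornerX hornerC /partial_sum big_ord_recr qpochS /=.
have := qpoch_neq0 n z0; move: (qpoch q _ n) (\sum_(k < n) _) => x y x0.
by field.
Qed.

Lemma partial_sum_node N n : (N < n)%N -> (forall k, 1 - al * q ^+ N.+1 * q ^+ k != 0) ->
  partial_sum (q ^+ N.+1) n = qpoch q (al * q) N * node_value N.
Proof.
move=> Nn z0; rewrite -qbailey_inversion //.
pose F k := term_coef k * qpoch_shift q (q ^+ N.+1) k / qpoch q (al * q ^+ N.+1) k.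
rewrite /partial_sum -(big_mkord xpredT F) (@big_cat_nat _ _ _ N.+1) //=.
rewrite [X in _ + X]big_nat [X in _ + X]big1 ?addr0 ?big_mkord => [|k /andP[Nk _]].
  by apply: eq_bigr => k _; rewrite /F /term_coef /inner invfM; ring.
rewrite /F /qpoch_shift (bigD1_seq N.+1) ?iota_uniq ?mem_index_iota //=.
by rewrite subrr mul0r !(mulr0, mul0r).
Qed.

Definition limit_const : C := qpoch_inf q (al * q) / qpoch_inf q (al * b) *
  \prod_(j < m) (qpoch_inf q (al * cs j) / qpoch_inf q (al * bs j)).

(** The theorem with both sides multiplied by their denominators and all
    infinite products cut at n; it has to tend to 0. *)
Definition gap_poly n : {poly C} :=
  partial_poly n * \prod_(j < m) qpoch_poly q (al * cs j / q) n -
  limit_const%:P * (qpoch_poly q (al * b / q) n *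
                    \prod_(j < m) qpoch_poly q (al * bs j / q) n).

Lemma horner_gap_poly z n : (gap_poly n).[z] =
  (partial_poly n).[z] * \prod_(j < m) qpoch q (al * cs j / q * z) n -
  limit_const * (qpoch q (al * b / q * z) n *
                 \prod_(j < m) qpoch q (al * bs j / q * z) n).
Proof.
rewrite /gap_poly hornerD hornerN !hornerM hornerC horner_qpoch_poly !horner_prod.
by congr (_ * _ - _ * (_ * _)); apply: eq_bigr => j _; rewrite horner_qpoch_poly.
Qed.

Lemma geometric_cauchy_gap (rho s : C) : 0 < rho -> 0 < s ->
  (forall j, `|al * cs j| < s) -> q <= s * rho / q -> s * rho / q < 1 ->
  geometric_cauchy rho (s * rho / q) gap_poly.
Proof.
move=> rho0 s0 css qth th1.
have [D D0 DP] := majorant_term_le rho0 s0 css.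
apply: geometric_cauchyB => //; apply: geometric_cauchyM => //.
- exact: (geometric_cauchy_rec (q := q)
            (d := fun n => term_coef n *: shift_poly n) _ _ _ _ D0).
- by apply: (geometric_cauchy_prod q01) => // j; exact: geometric_cauchy_qpoch.
- exact: (geometric_cauchyC _ q01).
apply: geometric_cauchyM => //; first exact: geometric_cauchy_qpoch.
by apply: (geometric_cauchy_prod q01) => // j; exact: geometric_cauchy_qpoch.
Qed.

Lemma cvg_prod_qpoch (x : 'I_m -> C) :
  (fun n => \prod_(j < m) qpoch q (x j) n) @ \oo --> \prod_(j < m) qpoch_inf q (x j).
Proof.
apply: cvg_big => [|j _]; first exact: mul_continuous.
exact: cvg_qpoch.
Qed.

Lemma prod_qpoch_infD (x : 'I_m -> C) N : \prod_(j < m) qpoch_inf q (x j) =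
  \prod_(j < m) qpoch q (x j) N * \prod_(j < m) qpoch_inf q (x j * q ^+ N).
Proof. by rewrite -big_split; apply: eq_bigr => j _; exact: qpoch_infD. Qed.

Lemma limit_const_split N : limit_const =
  qpoch q (al * q) N * qpoch_inf q (al * q ^+ N.+1) /
  (qpoch q (al * b) N * qpoch_inf q (al * b * q ^+ N)) *
  (\prod_(j < m) qpoch q (al * cs j) N *
   \prod_(j < m) qpoch_inf q (al * cs j * q ^+ N) /
   (\prod_(j < m) qpoch q (al * bs j) N *
    \prod_(j < m) qpoch_inf q (al * bs j * q ^+ N))).
Proof.
rewrite -!prod_qpoch_infD -prodf_div -(qpoch_infD q01 (al * b) N).
by rewrite /limit_const (qpoch_infD q01 (al * q) N) -[al * q * _]mulrA -exprS.
Qed.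

(** Here the theorem holds at the node by [qbailey_inversion]; splitting each
    infinite product at N matches the two sides. *)
Lemma cvg_gap_node N : `|al * q ^+ N.+1| < 1 ->
  (fun n => (gap_poly n).[q ^+ N.+1]) @ \oo --> (0 : C).
Proof.
move=> z1; have z0 k : 1 - al * q ^+ N.+1 * q ^+ k != 0 by exact: subr1_qX_neq0.
have shift x : x / q * q ^+ N.+1 = x * q ^+ N.
  by rewrite exprS mulrA divfK.
rewrite -(cvg_shiftn N.+1).
pose u n := qpoch q (al * q ^+ N.+1) n * (qpoch q (al * q) N * node_value N) *
    \prod_(j < m) qpoch q (al * cs j * q ^+ N) n -
  limit_const * (qpoch q (al * b * q ^+ N) n *
                 \prod_(j < m) qpoch q (al * bs j * q ^+ N) n).
have -> : [sequence (gap_poly (n + N.+1)%N).[q ^+ N.+1]]_n = [sequence u (n + N.+1)%N]_n.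
  apply/funext => n; rewrite /= horner_gap_poly horner_partial_poly //.
  rewrite partial_sum_node ?leq_addl // shift /u.
  by congr (_ * _ - _ * (_ * _)); apply: eq_bigr => j _; rewrite shift.
rewrite (cvg_shiftn N.+1 u).
pose l := qpoch_inf q (al * q ^+ N.+1) * (qpoch q (al * q) N * node_value N) *
    \prod_(j < m) qpoch_inf q (al * cs j * q ^+ N) -
  limit_const * (qpoch_inf q (al * b * q ^+ N) *
                 \prod_(j < m) qpoch_inf q (al * bs j * q ^+ N)).
suff l0 : l = 0.
  have : u @ \oo --> l; last by rewrite l0.
  apply: cvgB; apply: cvgM.
  - by apply: cvgMl; exact: cvg_qpoch.
  - exact: cvg_prod_qpoch.
  - exact: cvg_cst.
  - by apply: cvgM; [exact: cvg_qpoch|exact: cvg_prod_qpoch].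
apply/eqP; rewrite subr_eq0 (limit_const_split N) /node_value prodf_div; apply/eqP.
have split_neq0 x : `|x| < 1 -> qpoch q x N != 0 /\ qpoch_inf q (x * q ^+ N) != 0.
  move=> /(qpoch_inf_neq0 q01); rewrite (qpoch_infD q01 x N) mulf_eq0 negb_or.
  by move/andP.
have [b0 b1] := split_neq0 _ alb1.
have d0 : \prod_(j < m) qpoch q (al * bs j) N != 0.
  by apply/prodf_neq0 => j _; case: (split_neq0 _ (albs1 j)).
have d1 : \prod_(j < m) qpoch_inf q (al * bs j * q ^+ N) != 0.
  by apply/prodf_neq0 => j _; case: (split_neq0 _ (albs1 j)).
exact: node_identity.
Qed.

Theorem cvg_partial_sum : partial_sum a @ \oo -->
  limit_const * (qpoch_inf q (al * b / q * a) *
     \prod_(j < m) qpoch_inf q (al * bs j / q * a)) /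
  (qpoch_inf q (al * a) * \prod_(j < m) qpoch_inf q (al * cs j / q * a)).
Proof.
have [rho [rho0 arho alrho csrho]] := exists_radius.
have [s [s0 css qth th1]] := exists_rate rho0 csrho.
have G := geometric_cauchy_gap rho0 s0 css qth th1.
have gap0 : (fun n => (gap_poly n).[a]) @ \oo --> (0 : C).
  apply: (identity_principle q01 rho0 qth th1 G) => // e e0.
  have [M hM] := exists_qX_lt q01 e0; have [N hN] := exists_qX_lt q01 rho0.
  have q1 : q <= 1 by case/andP: q01 => _ /ltW.
  have zrho : `|q ^+ (M + N).+1| <= rho.
    by rewrite ger0_norm // (le_trans _ (ltW hN)) // ler_wiXn2l // leqW // leq_addl.
  exists (q ^+ (M + N).+1); split=> //; first exact: qX_neq0.
    by rewrite ger0_norm // (le_lt_trans _ hM) // ler_wiXn2l // leqW // leq_addr.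
  by apply: cvg_gap_node; rewrite normrM (le_lt_trans _ alrho) // ler_wpM2l.
have cs0 j : `|al * cs j / q * a| < 1 by rewrite mulrAC [_ * cs j * a]mulrAC.
have a0 k : 1 - al * a * q ^+ k != 0 by exact: subr1_qX_neq0.
have csn n : \prod_(j < m) qpoch q (al * cs j / q * a) n != 0.
  by apply/prodf_neq0 => j _; apply: qpoch_neq0 => k; exact: subr1_qX_neq0.
have -> : partial_sum a = (fun n => ((gap_poly n).[a] + limit_const *
    (qpoch q (al * b / q * a) n * \prod_(j < m) qpoch q (al * bs j / q * a) n)) /
    (qpoch q (al * a) n * \prod_(j < m) qpoch q (al * cs j / q * a) n)).
  apply/funext => n; rewrite horner_gap_poly subrK horner_partial_poly //.
  rewrite [_ * partial_sum a n]mulrC -[X in _ = X / _]mulrA.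
  by rewrite mulfK // mulf_neq0 // qpoch_neq0.
have numer : (fun n => limit_const *
    (qpoch q (al * b / q * a) n * \prod_(j < m) qpoch q (al * bs j / q * a) n)) @ \oo -->
    limit_const * (qpoch_inf q (al * b / q * a) *
                   \prod_(j < m) qpoch_inf q (al * bs j / q * a)).
  apply: cvgMr; apply: cvgM; [exact: cvg_qpoch|exact: cvg_prod_qpoch].
have := cvgD gap0 numer; rewrite add0r => sumcvg.
apply: cvgM; first exact: sumcvg.
apply: cvgV.
  apply: mulf_neq0; first exact: qpoch_inf_neq0.
  by apply/prodf_neq0 => j _; exact: qpoch_inf_neq0.
by apply: cvgM; [exact: cvg_qpoch|exact: cvg_prod_qpoch].
Qed.

End Expansion.
Theorem theorem1p4 (R : realType) (q0 : R) (hq : 0 < q0 < 1) (m : nat)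
    (al a b : Cplx R) (bs cs : 'I_m -> Cplx R) :
  let q : Cplx R := of_real q0 in
  `|al * a| < 1 -> `|al * b| < 1 ->
  (forall j, `|al * bs j| < 1 /\ `|al * a * cs j / q| < 1) ->
  series (fun n : nat =>
      qpoch_vwp q al n * qpoch_shift q a n / qpochs q [:: q; al * a] n *
      bhs [tuple of q ^- n :: al * q ^+ n :: [tuple al * cs j | j < m]]
          [tuple of al * b :: [tuple al * bs j | j < m]] q q) @ \oo
  --> qpochs_inf q [:: al * q; al * a * b / q] / qpochs_inf q [:: al * a; al * b] *
      \prod_(j < m) (qpochs_inf q [:: al * a * bs j / q; al * cs j] /
                     qpochs_inf q [:: al * a * cs j / q; al * bs j]).
Proof.
move=> q ala1 alb1 h.
have q01 : 0 < q < 1 by rewrite -[0]/(of_real 0) -[1]/(of_real 1) !ltr_of_real.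
have albs1 j : `|al * bs j| < 1 by case: (h j).
have acs1 j : `|al * a * cs j / q| < 1 by case: (h j).
have := cvg_partial_sum q01 ala1 alb1 albs1 acs1.
rewrite (_ : partial_sum _ _ _ _ _ _ = series (fun n : nat =>
      qpoch_vwp q al n * qpoch_shift q a n / qpochs q [:: q; al * a] n *
      bhs [tuple of q ^- n :: al * q ^+ n :: [tuple al * cs j | j < m]]
          [tuple of al * b :: [tuple al * bs j | j < m]] q q)); last first.
  apply/funext => n; rewrite /series /= big_mkord; apply: eq_bigr => k _.
  rewrite bhs_inner // /qpochs !big_cons big_nil mulr1 /term_coef invfM.
  by move: (qpoch_vwp _ _ _) (qpoch_shift _ _ _) => x y; ring.
rewrite [X in _ --> X -> _](_ : _ =
  qpochs_inf q [:: al * q; al * a * b / q] / qpochs_inf q [:: al * a; al * b] *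
      \prod_(j < m) (qpochs_inf q [:: al * a * bs j / q; al * cs j] /
                     qpochs_inf q [:: al * a * cs j / q; al * bs j])) //.
have comm x : al * x / q * a = al * a * x / q by ring.
rewrite !qpochs_inf_pair /limit_const prodf_div comm.
transitivity (qpoch_inf q (al * q) * qpoch_inf q (al * a * b / q) /
  (qpoch_inf q (al * a) * qpoch_inf q (al * b)) *
  (\prod_(j < m) qpoch_inf q (al * bs j / q * a) * \prod_(j < m) qpoch_inf q (al * cs j) /
   (\prod_(j < m) qpoch_inf q (al * cs j / q * a) * \prod_(j < m) qpoch_inf q (al * bs j)))).
  exact: regroup_fractions.
congr (_ * _); rewrite -!big_split -prodf_div; apply: eq_bigr => j _.
by rewrite /= !qpochs_inf_pair !comm.
Qed.
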